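(* Let $R$ be an iterated local skew power series ring in the ordered list of variables $x_1,\dots,x_n$ of type (A) or (B), and let $\preceq$ be a monomial order on $R$. Suppose $I$ is a nonzero left ideal of $R$ and $G=(g_1,\dots,g_s)$ is a left ideal basis for $I$. Then $G$ is a Gröbner basis for $I$ if and only if $\overline{S(g_i,g_j)}^G=0$ for all $1\le i,j\le s$.
   Context: $\mathbb{N}$ contains $0$. A skew derivation on a ring $B$ is a pair $(\sigma,\delta)$ with $\sigma$ an automorphism of $B$ and $\delta:B\to B$ additive with $\delta(rs)=\delta(r)s+\sigma(r)\delta(s)$. If $(B,\mathfrak m)$ is a complete local ring, $(\sigma,\delta)$ is local if $\sigma(\mathfrak m^i)=\mathfrak m^i$ and $\delta(\mathfrak m^i)\subseteq\mathfrak m^{i+1}$ for all $i\ge 0$; then the skew power series ring $B[[x;\sigma,\delta]]$ exists: it is the left $B$-module of formal power series $\sum_j b_jx^j$ with the continuous multiplication extending $xr=\sigma(r)x+\delta(r)$ $(r\in B)$, and it is again complete local. If $A\subseteq B$ is a subring, $(\sigma,\delta)$ is $A$-linear if $\sigma(a)=a$ and $\delta(a)=0$ for all $a\in A$. The ring $R$ is one of the following. Case (A): $A=k$ is a finite field of characteristic $p$, $R_0=A$, and for $1\le i\le n$, $R_i=R_{i-1}[[x_i;\sigma_i,\delta_i]]$ with $(\sigma_i,\delta_i)$ a local, $A$-linear skew derivation on $R_{i-1}$. Put $R=R_n$. Case (B): $A$ is a (commutative) complete discrete valuation ring of characteristic $0$, not a field, with residue field $k$ a finite field of characteristic $p$;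 $x_1$ is a fixed uniformiser of $A$; $R_1=A$, and for $2\le i\le n$, $R_i=R_{i-1}[[x_i;\sigma_i,\delta_i]]$ with $(\sigma_i,\delta_i)$ a local, $A$-linear skew derivation on $R_{i-1}$. Put $R=R_n$. Let $\iota:k\to A$ be the unique multiplicative section of $A\to k$ (the identity in case (A)). For $\alpha\in\mathbb{N}^n$ write $x^\alpha=x_1^{\alpha_1}\cdots x_n^{\alpha_n}$. Every $r\in R$ is uniquely $r=\sum_{\alpha\in\mathbb{N}^n}r_\alpha x^\alpha$ with $r_\alpha\in\iota(k)$; $\mathrm{supp}(r)=\{\alpha:r_\alpha\ne0\}$. An additive total order on $\mathbb{N}^n$ is a total order with $0\prec\alpha$ for all $\alpha\neq 0$, and $\alpha\prec\beta\Rightarrow\alpha+\gamma\prec\beta+\gamma$ (it is automatically a well-order). For $r\ne0$, $\mathrm{LM}(r)=\min_\preceq\mathrm{supp}(r)$, and $\mathrm{LC}(r)=r_{\mathrm{LM}(r)}\in\iota(k)^\times$ (a central unit of $R$). A monomial order on $R$ is an additive total order $\preceq$ with $\mathrm{LM}_\preceq(x^\alpha x^\beta)=\alpha+\beta$ for all $\alpha,\beta\in\mathbb{N}^n$. For $S\subseteq R$ (or a tuple), $\mathrm{LM}(S)=\{\mathrm{LM}(s):s\in S\setminus\{0\}\}$; for $T\subseteq\mathbb{N}^n$, $\langle T\rangle=\bigcup_{t\in T}(t+\mathbb{N}^n)$. A left ideal basis for a left ideal $I$ is a finite ordered tuple $G=(g_1,\dots,g_s)$ of nonzero elements of $I$ with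 $I=Rg_1+\dots+Rg_s$; it is a Gröbner basis for $I$ if $\mathrm{LM}(I)=\langle\mathrm{LM}(G)\rangle$. Right-division: for a tuple $G=(g_1,\dots,g_s)$ of nonzero elements put $\Delta_{G,r}=(\mathrm{LM}(g_r)+\mathbb{N}^n)\setminus\bigcup_{i<r}\Delta_{G,i}$ and $\overline\Delta_G=\mathbb{N}^n\setminus\bigcup_{i=1}^s\Delta_{G,i}$. Every $f\in R$ is uniquely $f=q_1g_1+\dots+q_sg_s+r$ with $\mathrm{supp}(q_i)+\mathrm{LM}(g_i)\subseteq\Delta_{G,i}$ for all $i$ and $\mathrm{supp}(r)\subseteq\overline\Delta_G$; the remainder is $\overline f^G:=r$. S-elements: for $\alpha,\beta\in\mathbb{N}^n$ let $\alpha\vee\beta$ be the componentwise maximum. For nonzero $g,g'\in R$ with $\mathrm{LM}(g)=\gamma$, $\mathrm{LM}(g')=\gamma'$, put $\beta=(\gamma\vee\gamma')-\gamma$, $\beta'=(\gamma\vee\gamma')-\gamma'$, and $$S(g,g')=\frac{x^\beta g}{\mathrm{LC}(x^\beta g)}-\frac{x^{\beta'}g'}{\mathrm{LC}(x^{\beta'}g')}.$$ *)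

(* Defs.v *)
From HB Require Import structures.
From mathcomp Require Import all_boot all_order all_algebra.
From mathcomp Require Import boolp classical_sets.
From mathcomp Require Import mpoly.

Set Implicit Arguments.
Unset Strict Implicit.
Unset Printing Implicit Defensive.

Import GRing.Theory.
Local Open Scope classical_set_scope.
Local Open Scope ring_scope.

(* Rings are [unitRingType]s: with classical logic every nonzero ring carries
   such a structure, [GRing.unit] is the set of two-sided invertible elements,
   and [x / y] is x * y^-1. *)

Definition left_ideal (R : unitRingType) (I : set R) : Prop :=
  [/\ I 0, forall a b, I a -> I b -> I (a + b) & forall r a, I a -> I (r * a)].

(* For a local ring, the maximal ideal is the set of non-units. *)
Definition max_ideal (B : unitRingType) : set B :=
  [set b | b \isn't a GRing.unit].

(* The additive subgroup generated by the products a * b, a in I, b in J. *)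
Definition ideal_prod (B : unitRingType) (I J : set B) : set B :=
  [set b | exists s : seq (B * B),
     (forall u, u \in s -> I u.1 /\ J u.2) /\ b = \sum_(u <- s) u.1 * u.2].

Fixpoint ideal_pow (B : unitRingType) (I : set B) (i : nat) : set B :=
  if i is i'.+1 then ideal_prod I (ideal_pow I i') else setT.

Definition mpow (B : unitRingType) (i : nat) : set B :=
  ideal_pow (@max_ideal B) i.
Arguments mpow : clear implicits.

(* A = lim A/m^i; a compatible system of classes is given by representatives
   u_i with u_(i+1) = u_i mod m^i. *)
Definition adic_complete (A : unitRingType) : Prop :=
  (forall a : A, (forall i, mpow A i a) -> a = 0) /\
  (forall u : nat -> A, (forall i, mpow A i (u i.+1 - u i)) ->
     exists l, forall i, mpow A i (l - u i)).

(* A local principal ideal domain which is not a field. *)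
Definition is_dvr (A : idomainType) : Prop :=
  [/\ forall a b : A, max_ideal a -> max_ideal b -> max_ideal (a + b),
      forall I : set A, left_ideal I ->
        exists a, I = [set b | exists c, b = c * a]
    & exists2 a : A, a != 0 & max_ideal a].

Definition uniformiser (A : idomainType) (pi : A) : Prop :=
  @max_ideal A = [set b | exists c, b = c * pi].

(* The coefficient ring A, its residue map onto k, and the initial list of
   variables: empty when A = k, the uniformiser x1 when A is a complete DVR. *)
Inductive coefficient_ring (k : finFieldType) (A : idomainType)
    (res : {rmorphism A -> k}) : seq A -> Prop :=
| coefficient_field : bijective res -> coefficient_ring res [::]
| coefficient_cdvr (x1 : A) :
    is_dvr A -> adic_complete A -> [pchar A] =i pred0 ->
    (forall c : k, exists a : A, res a = c) ->
    (forall a : A, max_ideal a <-> res a = 0) ->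
    uniformiser x1 ->
    coefficient_ring res [:: x1].

Definition mult_section (k : finFieldType) (A : idomainType)
    (res : {rmorphism A -> k}) (iota : k -> A) : Prop :=
  {morph iota : a b / a * b} /\ cancel iota res.

Definition skew_derivation (B : unitRingType) (sigma : {rmorphism B -> B})
    (delta : {additive B -> B}) : Prop :=
  bijective sigma /\
  forall r s, delta (r * s) = delta r * s + sigma r * delta s.

Definition local_skew_derivation (B : unitRingType)
    (sigma : {rmorphism B -> B}) (delta : {additive B -> B}) : Prop :=
  [/\ skew_derivation sigma delta,
      forall i, sigma @` mpow B i = mpow B i
    & forall i, delta @` mpow B i `<=` mpow B i.+1].

Definition linear_skew_derivation (A B : unitRingType) (eta : {rmorphism A -> B})
    (sigma : {rmorphism B -> B}) (delta : {additive B -> B}) : Prop :=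
  forall a, sigma (eta a) = eta a /\ delta (eta a) = 0.

(* S, containing B through j, is B[[x; sigma, delta]]: the function cf, sending
   sum_l b_l x^l to (b_l)_l, identifies the left B-module S with the module of
   all sequences in B, and the multiplication extends x b = sigma(b) x + delta(b)
   and is continuous for the product of the max_ideal-adic topologies.  These
   conditions determine S up to a unique isomorphism over B and x. *)
Definition skew_power_series (B S : unitRingType) (j : {rmorphism B -> S})
    (x : S) (sigma : {rmorphism B -> B}) (delta : {additive B -> B}) : Prop :=
  exists cf : S -> nat -> B,
    [/\ injective cf /\ (forall b : nat -> B, exists f, forall l, cf f l = b l),
        forall b f g l, cf (j b * f + g) l = b * cf f l + cf g l,
        forall i l, cf (x ^+ i) l = (l == i)%:R,
        forall b, x * j b = j (sigma b) * x + j (delta b)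
      & let near N f f' := forall l, (l < N)%N -> mpow B N (cf f' l - cf f l) in
        forall f g N, exists M, forall f' g',
          near M f f' -> near M g g' -> near N (f * g) (f' * g')].

(* R is an iterated local skew power series ring over A, with structure map
   eta : A -> R and ordered list of variables xs (starting with xs0). *)
Inductive iterated_skew_power_series (A : unitRingType) (xs0 : seq A) :
    forall R : unitRingType, {rmorphism A -> R} -> seq R -> Prop :=
| iterated_base : iterated_skew_power_series xs0 (idfun : {rmorphism A -> A}) xs0
| iterated_step (B : unitRingType) (eta : {rmorphism A -> B}) (xs : seq B)
    (sigma : {rmorphism B -> B}) (delta : {additive B -> B})
    (S : unitRingType) (j : {rmorphism B -> S}) (x : S) :
    iterated_skew_power_series xs0 eta xs ->
    local_skew_derivation sigma delta ->
    linear_skew_derivation eta sigma delta ->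
    skew_power_series j x sigma delta ->
    iterated_skew_power_series xs0 (j \o eta : {rmorphism A -> S})
      (rcons (map j xs) x).

(* In the definitions below, tau : k -> R is the composite of iota : k -> A with
   the structure map A -> R, x is the tuple of variables and le the order. *)

Section Groebner.

Context (k : finFieldType) (R : unitRingType) (tau : k -> R)
        (n : nat) (x : n.-tuple R) (le : rel 'X_{1..n}).

Definition xmon (al : 'X_{1..n}) : R := \prod_(i < n) tnth x i ^+ al i.

(* Unconditional convergence in the max_ideal-adic topology of R. *)
Definition has_sum (u : 'X_{1..n} -> R) (r : R) : Prop :=
  forall N, exists F0 : seq 'X_{1..n}, forall F : seq 'X_{1..n},
    uniq F -> {subset F0 <= F} -> mpow R N (r - \sum_(al <- F) u al).

Definition expansion (r : R) (c : 'X_{1..n} -> R) : Prop :=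
  (forall al, range tau (c al)) /\ has_sum (fun al => c al * xmon al) r.

Definition coef (r : R) : 'X_{1..n} -> R :=
  xget (fun=> 0) [set c | expansion r c].

Definition supp (r : R) : set 'X_{1..n} := [set al | coef r al != 0].

Definition prec (al be : 'X_{1..n}) : bool := (al != be) && le al be.

Definition additive_order : Prop :=
  [/\ [/\ reflexive le, antisymmetric le, transitive le & total le],
      forall al, al != 0%MM -> prec 0%MM al
    & forall al be ga, prec al be -> prec (al + ga)%MM (be + ga)%MM].

Definition LM (r : R) : 'X_{1..n} :=
  xget 0%MM [set al | supp r al /\ forall be, supp r be -> le al be].

Definition LC (r : R) : R := coef r (LM r).

Definition monomial_order : Prop :=
  additive_order /\ forall al be, LM (xmon al * xmon be) = (al + be)%MM.

Definition LMset (S : set R) : set 'X_{1..n} :=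
  [set al | exists s, [/\ S s, s != 0 & al = LM s]].

Definition upset (T : set 'X_{1..n}) : set 'X_{1..n} :=
  [set al | exists t be, T t /\ al = (t + be)%MM].

Definition left_ideal_basis (I : set R) (s : nat) (G : s.-tuple R) : Prop :=
  (forall i, I (tnth G i) /\ tnth G i != 0) /\
  I = [set f | exists q : 'I_s -> R, f = \sum_(i < s) q i * tnth G i].

Definition groebner_basis (I : set R) (s : nat) (G : s.-tuple R) : Prop :=
  left_ideal_basis I G /\ LMset I = upset (LMset [set g | g \in tval G]).

(* The list of the Delta_(G,i), [used] being the union of the previous ones. *)
Fixpoint Deltas (used : set 'X_{1..n}) (G : seq R) : seq (set 'X_{1..n}) :=
  if G is g :: G' then
    let D := upset [set LM g] `\` used in D :: Deltas (used `|` D) G'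
  else [::].

Definition Delta (s : nat) (G : s.-tuple R) (i : 'I_s) : set 'X_{1..n} :=
  nth set0 (Deltas set0 G) i.

Definition Deltabar (s : nat) (G : s.-tuple R) : set 'X_{1..n} :=
  [set al | forall i : 'I_s, ~ Delta G i al].

Definition right_division (s : nat) (G : s.-tuple R) (f : R)
    (q : 'I_s -> R) (r : R) : Prop :=
  [/\ f = \sum_(i < s) q i * tnth G i + r,
      forall i al, supp (q i) al -> Delta G i (al + LM (tnth G i))%MM
    & supp r `<=` Deltabar G].

Definition remainder (s : nat) (G : s.-tuple R) (f : R) : R :=
  xget f [set r | exists q, right_division G f q r].

Definition Selem (g g' : R) : R :=
  let m := mlcm (LM g) (LM g') in
  let xg := xmon (m - LM g)%MM * g in
  let xg' := xmon (m - LM g')%MM * g' in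
  xg / LC xg - xg' / LC xg'.

End Groebner.

(* Main.v *)
(* Every element of R has a digit expansion with digits in the finite field k.
   Adding two expansions only produces carries at larger exponents, so leading
   monomials behave as in a domain.  Division by G is a transfinite recursion
   along the monomial order, which is a well-order by Dickson's lemma.

   If all S-elements reduce to 0, take f = sum_i h_i g_i and call a term of h_i
   inadmissible when its product with the leading term of g_i has an exponent
   outside Delta_(G,i).  The inadmissible terms of lowest exponent can be
   rewritten by means of the S-elements, which otherwise changes h only at
   higher exponents.  These can increase forever below a fixed exponent, so this
   process need not converge by itself; but k is finite, hence the digit sequences form a compact space, and a
   representation of f that is as admissible as possible exists.  It has no
   inadmissible terms, so it exhibits LM(f) as a multiple of some LM(g_j). *)

Require Import Defs.
From HB Require Import structures.
From mathcomp Require Import all_boot all_order all_algebra.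
From mathcomp Require Import boolp classical_sets.
From mathcomp Require Import mpoly.

Set Implicit Arguments.
Unset Strict Implicit.
Unset Printing Implicit Defensive.

Import GRing.Theory.
Local Open Scope classical_set_scope.
Local Open Scope ring_scope.

(** * Local rings and the powers of the maximal ideal *)

(** In mixed characteristic the digit maps are not additive, so sums cannot be treated digit by
    digit. What survives is this: if a set [U] of exponents is stable under adding exponents, the
    elements without digits outside [U] form a closed additive subgroup, and congruence modulo it is
    equality of digits outside [U]. Estimates on leading terms are therefore phrased with such
    subgroups. With [U] the exponents strictly above [ga], the digit at [ga] is not affected by
    adding anything supported in [U], and this replaces linearity. The digits themselves are built
    along the tower of variables. A product of skew series has no explicit coefficient formula, so
    the powers of the maximal ideal are first identified with an explicit filtration on
    coefficients; this makes digits and adic topology match. From leading monomials on, the ring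
    enters only through locality, completeness, [digit_map] and the monomial order. *)

Definition local_ring (B : unitRingType) : Prop :=
  (forall a b : B, max_ideal a -> max_ideal b -> max_ideal (a + b)) /\
  (forall r a : B, max_ideal a -> max_ideal (r * a) /\ max_ideal (a * r)).

Section LocalRing.
Context (B : unitRingType) (hB : local_ring B).

Lemma mpowS_ind (P : B -> Prop) i :
    P 0 -> (forall a b, P a -> P b -> P (a + b)) ->
    (forall a b, max_ideal a -> mpow B i b -> P (a * b)) ->
  forall r, mpow B i.+1 r -> P r.
Proof.
move=> P0 PD PM r [s [hs ->]]; elim: s hs => [|u s IH] hs;
  first by rewrite big_nil.
rewrite big_cons; apply: PD; last first.
  by apply: IH => v hv; apply: hs; rewrite inE hv orbT.
by have [] := hs u (mem_head _ _); apply: PM.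
Qed.

Lemma mpowS_mul i a b : max_ideal a -> mpow B i b -> mpow B i.+1 (a * b).
Proof.
move=> ha hb; exists [:: (a, b)]; split; last by rewrite big_seq1.
by move=> u; rewrite inE => /eqP ->.
Qed.

Lemma mpow_0 i : mpow B i 0.
Proof. by case: i => [//|i]; exists [::]; split=> //; rewrite big_nil. Qed.

Lemma mpowD i a b : mpow B i a -> mpow B i b -> mpow B i (a + b).
Proof.
case: i => [//|i] [s [hs ->]] [t [ht ->]]; exists (s ++ t); rewrite big_cat.
by split=> // u; rewrite mem_cat => /orP[/hs|/ht].
Qed.

Lemma mpow_sum i (T : Type) (s : seq T) (P : pred T) (F : T -> B) :
  (forall t, P t -> mpow B i (F t)) -> mpow B i (\sum_(t <- s | P t) F t).
Proof. by move=> hF; apply: big_ind => //; [apply: mpow_0|apply: mpowD]. Qed.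

Lemma mpowMl i r a : mpow B i a -> mpow B i (r * a).
Proof.
case: i => [//|i].
apply: (@mpowS_ind (fun a => mpow B i.+1 (r * a))) => [|b c hb hc|b c hb hc].
- by rewrite mulr0; apply: mpow_0.
- by rewrite mulrDr; apply: mpowD.
by rewrite mulrA; apply: mpowS_mul => //; case: (hB.2 r _ hb).
Qed.

Lemma mpowMr i r a : mpow B i a -> mpow B i (a * r).
Proof.
elim: i a => [//|i IH].
apply: (@mpowS_ind (fun a => mpow B i.+1 (a * r))) => [|b c hb hc|b c hb hc].
- by rewrite mul0r; apply: mpow_0.
- by rewrite mulrDl; apply: mpowD.
by rewrite -mulrA; apply: mpowS_mul => //; apply: IH.
Qed.

Lemma mpowN i a : mpow B i a -> mpow B i (- a).
Proof. by move=> ha; rewrite -mulN1r; apply: mpowMl. Qed.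

Lemma mpowM i j a b : mpow B i a -> mpow B j b -> mpow B (i + j) (a * b).
Proof.
move=> + hb; elim: i a => [|i IH] a; first by move=> _; apply: mpowMl.
apply: (@mpowS_ind (fun a => mpow B (i.+1 + j) (a * b)))=> [|c d hc hd|c d hc
  hd].
- by rewrite mul0r; apply: mpow_0.
- by rewrite mulrDl; apply: mpowD.
by rewrite -mulrA addSn; apply: mpowS_mul => //; apply: IH.
Qed.

Lemma mpowS i a : mpow B i.+1 a -> mpow B i a.
Proof.
by apply: (@mpowS_ind (mpow B i)) => [|b c|b c _];
  [apply: mpow_0|apply: mpowD|apply: mpowMl].
Qed.

Lemma mpow_le i j a : (i <= j)%N -> mpow B j a -> mpow B i a.
Proof.
by move=> /subnK <-; elim: (j - i)%N => [//|m IH] /mpowS.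
Qed.

Lemma max_ideal0 : max_ideal (0 : B).
Proof. by rewrite /max_ideal /= unitr0. Qed.

Lemma mpow1E a : mpow B 1 a <-> max_ideal a.
Proof.
split; last by move=> ha; rewrite -[a]mulr1; apply: mpowS_mul.
apply: (@mpowS_ind (@max_ideal B)) => [|b c|b c hb _].
- exact: max_ideal0.
- exact: hB.1.
by case: (hB.2 c _ hb).
Qed.

Lemma adic_separated : adic_complete B ->
  forall a b : B, (forall i, mpow B i (a - b)) -> a = b.
Proof. by move=> [h _] a b hab; apply/eqP; rewrite -subr_eq0; apply/eqP/h. Qed.

End LocalRing.

(** * Skew power series over a complete local ring *)

Section SkewPowerSeries.
Context (B S : unitRingType) (hB : local_ring B) (cB : adic_complete B)
        (sigma : {rmorphism B -> B}) (delta : {additive B -> B})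
        (hsd : local_skew_derivation sigma delta)
        (j : {rmorphism B -> S}) (x : S) (cf : S -> nat -> B).

Let near N f f' := forall l, (l < N)%N -> mpow B N (cf f' l - cf f l).

Context (cf_inj : injective cf)
        (cf_surj : forall b : nat -> B, exists f, forall l, cf f l = b l)
        (cf_lin : forall b f g l, cf (j b * f + g) l = b * cf f l + cf g l)
        (cf_x : forall i l, cf (x ^+ i) l = (l == i)%:R)
        (xj : forall b, x * j b = j (sigma b) * x + j (delta b))
        (cf_cont : forall f g N, exists M, forall f' g',
            near M f f' -> near M g g' -> near N (f * g) (f' * g')).

Lemma cf_0 l : cf 0 l = 0.
Proof.
have := cf_lin 1 0 0 l; rewrite rmorph1 !mul1r addr0 => /esym/eqP.
by rewrite -subr_eq0 addrK => /eqP.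
Qed.

Lemma cf_Ml b f l : cf (j b * f) l = b * cf f l.
Proof. by rewrite -[j b * f]addr0 cf_lin cf_0 addr0. Qed.

Lemma cf_D f g l : cf (f + g) l = cf f l + cf g l.
Proof. by rewrite -[f]mul1r -(rmorph1 j) cf_lin rmorph1 !mul1r. Qed.

Lemma cf_N f l : cf (- f) l = - cf f l.
Proof. by rewrite -mulN1r -(rmorph1 j) -rmorphN cf_Ml mulN1r. Qed.

Lemma cf_B f g l : cf (f - g) l = cf f l - cf g l.
Proof. by rewrite cf_D cf_N. Qed.

Lemma cf_sum (T : Type) (s : seq T) (P : pred T) (F : T -> S) l :
  cf (\sum_(t <- s | P t) F t) l = \sum_(t <- s | P t) cf (F t) l.
Proof.
by apply: (big_morph (cf^~ l)) => [f g|]; [exact: cf_D|exact: cf_0].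
Qed.

Lemma cf_jx b i l : cf (j b * x ^+ i) l = if l == i then b else 0.
Proof. by rewrite cf_Ml cf_x; case: eqP; rewrite ?mulr1 ?mulr0. Qed.

Lemma cf_j b l : cf (j b) l = if l == 0%N then b else 0.
Proof. by rewrite -[j b]mulr1 -(expr0 x) cf_jx. Qed.

Lemma cf_eq f g : (forall l, cf f l = cf g l) -> f = g.
Proof. by move=> h; apply: cf_inj; apply: funext. Qed.

Definition trunc (f : S) (M : nat) : S := \sum_(l < M) j (cf f l) * x ^+ l.

Lemma cf_trunc f M l : cf (trunc f M) l = if (l < M)%N then cf f l else 0.
Proof.
rewrite /trunc cf_sum; under eq_bigr do rewrite cf_jx.
case: ltnP => h.
  rewrite (bigD1 (Ordinal h)) //= eqxx big1 ?addr0 // => i.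
  by rewrite -val_eqE /= eq_sym => /negPf ->.
rewrite big1 // => i _; case: eqP => // e.
by have := ltn_ord i; rewrite -e ltnNge h.
Qed.

(* It turns out to be the N-th power of the maximal ideal of S; the
   subtraction is truncated, so that only the coefficients cf f l with l < N
   are constrained. *)
Definition filt (N : nat) (f : S) : Prop := forall l, mpow B (N - l) (cf f l).

Lemma filt_0 N : filt N 0.
Proof. by move=> l; rewrite cf_0; apply: mpow_0. Qed.

Lemma filtD N f g : filt N f -> filt N g -> filt N (f + g).
Proof. by move=> hf hg l; rewrite cf_D; apply: mpowD. Qed.

Lemma filtN N f : filt N f -> filt N (- f).
Proof. by move=> hf l; rewrite cf_N; apply: mpowN. Qed.

Lemma filtB N f g : filt N f -> filt N g -> filt N (f - g).
Proof. by move=> hf hg; apply: filtD => //; apply: filtN. Qed.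

Lemma filt_sum N (T : Type) (s : seq T) (P : pred T) (F : T -> S) :
  (forall t, P t -> filt N (F t)) -> filt N (\sum_(t <- s | P t) F t).
Proof. by move=> hF; apply: big_ind => //; [apply: filt_0|apply: filtD]. Qed.

Lemma filt_le M N f : (M <= N)%N -> filt N f -> filt M f.
Proof. by move=> h hf l; apply: mpow_le (hf l) => //; apply: leq_sub2r. Qed.

Lemma filt_separated f g : (forall N, filt N (f - g)) -> f = g.
Proof.
move=> h; apply: cf_eq => l; apply: (adic_separated cB) => i.
by have := h (i + l)%N l; rewrite addnK cf_B.
Qed.

Lemma near_trunc f M : near M f (trunc f M).
Proof. by move=> l hl; rewrite cf_trunc hl subrr; apply: mpow_0. Qed.

Lemma near_refl M f : near M f f.
Proof. by move=> l hl; rewrite subrr; apply: mpow_0. Qed.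

Lemma near_filt N f f' : near N f f' -> filt N (f - f').
Proof.
move=> h l; case: (ltnP l N) => hl.
  rewrite -opprB cf_N; apply: mpowN => //; rewrite cf_B.
  by apply: mpow_le (h l hl); rewrite // leq_subr.
by have -> : (N - l = 0)%N by apply/eqP.
Qed.

(** Products are only known to be continuous. Approximation by truncations reduces statements about
    them to finite sums, where the commutation rule for [x] applies. *)
Lemma mul_trunc_l f g N : exists M, filt N (f * g - trunc f M * g).
Proof.
have [M hM] := cf_cont f g N; exists M; apply: near_filt.
by apply: hM; [apply: near_trunc|apply: near_refl].
Qed.

Lemma mul_trunc_r f g N : exists M, forall M', (M <= M')%N ->
  filt N (f * g - f * trunc g M').
Proof.
have [M hM] := cf_cont f g N; exists M => M' hM'; apply: near_filt.
apply: hM; first exact: near_refl.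
move=> l hl; apply: (mpow_le hB hM').
by apply: near_trunc; apply: leq_trans hM'.
Qed.

Lemma cf_xM f l :
  cf (x * f) l = (if l is l'.+1 then sigma (cf f l') else 0) + delta (cf f l).
Proof.
apply: (adic_separated cB) => i.
(* [filt (i + l)] puts the coefficient of degree [l] in the [i]-th power. The cut is made beyond
   [l], so that truncation leaves the coefficients of [f] involved unchanged. *)
have [M hM] := mul_trunc_r x f (i + l).
have {hM} := hM _ (leq_maxl M l.+1); set M' := maxn _ _ => /(_ l).
rewrite addnK cf_B; congr (mpow B i (_ - _)).
rewrite /trunc mulr_sumr cf_sum.
under eq_bigr => m _ do
  rewrite mulrA xj mulrDl -mulrA -exprS cf_D !cf_jx.
have hl : (l < M')%N by rewrite leq_maxr.
clearbody M'.
rewrite big_split /=; congr (_ + _).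
  case: l hl => [|l] hl; first by rewrite big1.
  rewrite (bigD1 (Ordinal (ltnW hl))) //= eqxx big1 ?addr0 // => m.
  by rewrite -val_eqE /= eqSS eq_sym => /negPf ->.
rewrite (bigD1 (Ordinal hl)) //= eqxx big1 ?addr0 // => m.
by rewrite -val_eqE /= eq_sym => /negPf ->.
Qed.

Lemma cf_Mx f l : cf (f * x) l = if l is l'.+1 then cf f l' else 0.
Proof.
apply: (adic_separated cB) => i.
have [M hM] := cf_cont f x (i + l).
have {hM} := hM (trunc f (maxn M l.+1)) x; set M' := maxn _ _ => hM.
have {hM}/near_filt/(_ l) : near (i + l) (f * x) (trunc f M' * x).
  apply: hM; last exact: near_refl.
  move=> m hm; apply: (mpow_le hB (leq_maxl M l.+1)).
  by apply: near_trunc; apply: leq_trans (leq_maxl _ _).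
rewrite addnK cf_B; congr (mpow B i (_ - _)).
rewrite /trunc mulr_suml cf_sum.
under eq_bigr => m _ do rewrite -mulrA -exprSr cf_jx.
have hl : (l < M')%N by rewrite leq_maxr.
clearbody M'.
case: l hl => [|l] hl; first by rewrite big1.
rewrite (bigD1 (Ordinal (ltnW hl))) //= eqxx big1 ?addr0 // => m.
by rewrite -val_eqE /= eqSS eq_sym => /negPf ->.
Qed.

(** Locality of the skew derivation enters here: [sigma] keeps the power of the maximal ideal while
    the degree rises by one, and [delta] keeps the degree while the power rises by one. *)
Lemma filt_xM N f : filt N f -> filt N.+1 (x * f).
Proof.
case: hsd => _ hs hd hf l; rewrite cf_xM; apply: mpowD.
  case: l => [|l]; first exact: mpow_0.
  by rewrite subSS -hs; exists (cf f l).
apply: (@mpow_le _ hB _ (N - l).+1);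
  first by rewrite leq_subLR addnS ltnS -leq_subLR.
by apply: hd; exists (cf f l).
Qed.

Lemma filt_jM i N b f : mpow B i b -> filt N f -> filt (N + i) (j b * f).
Proof.
move=> hb hf l; rewrite cf_Ml.
apply: (@mpow_le _ hB _ (i + (N - l))); last exact: mpowM.
by rewrite leq_subLR addnCA [(N + i)%N]addnC leq_add2l -leq_subLR.
Qed.

Lemma filt_xnM N l f : filt N f -> filt (N + l) (x ^+ l * f).
Proof.
move=> hf; elim: l => [|l IH]; first by rewrite mul1r addn0.
by rewrite exprS -mulrA addnS; apply: filt_xM.
Qed.

(** After truncating [f], a term [j b * x ^+ l] gains [l] from [x ^+ l] and [M - l] from [b]. *)
Lemma filtM M N f g : filt M f -> filt N g -> filt (M + N) (f * g).
Proof.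
move=> hf hg; have [K hK] := mul_trunc_l f g (M + N).
rewrite -[f * g](subrK (trunc f K * g)); apply: filtD => //.
rewrite /trunc mulr_suml; apply: filt_sum => l _; rewrite -mulrA.
apply: (@filt_le _ (N + l + (M - l))).
  by rewrite addnC -addnA leq_add2l -leq_subLR.
by apply: filt_jM => //; apply: filt_xnM.
Qed.

Lemma filt0 f : filt 0 f.
Proof. by []. Qed.

Lemma filt1_nonunit f : filt 1 f -> max_ideal f.
Proof.
move=> hf; apply/negP => uf.
have := filtM hf (filt0 f^-1) => /(_ 0%N).
rewrite mulrV // -(expr0 x) cf_x eqxx => /(mpow1E hB).
by rewrite /max_ideal /= unitr1.
Qed.

Lemma filt_complete (u : nat -> S) : (forall i, filt i (u i.+1 - u i)) ->
  exists f, forall i, filt i (f - u i).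
Proof.
move=> hu.
(* The hypothesis controls coefficients of degree [l] only from index [l] on, so the sequence is
   started there. *)
have /choice[L hL] : forall l, exists b, forall i, mpow B i (b - cf (u (l +
  i)%N) l).
  move=> l; apply: cB.2 => i; have := hu (l + i)%N l.
  by rewrite cf_B addnS addKn.
have [f hf] := cf_surj L; exists f => i l; rewrite cf_B hf.
case: (leqP l i) => h; first by have := hL l (i - l)%N; rewrite subnKC.
by have /eqP -> : (i - l == 0)%N by rewrite subn_eq0 ltnW.
Qed.

(** Geometric series. The bound on [1 - g] allows a second application, to [g] itself, which turns
    the one-sided inverse into a two-sided one. *)
Lemma filt1_right_inv h : filt 1 h ->
  exists2 g, filt 1 (1 - g) & (1 - h) * g = 1.
Proof.
move=> hh; pose u i := \sum_(m < i) h ^+ m.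
have hpow i : filt i (h ^+ i).
  by elim: i => [//|i IH]; rewrite exprS -add1n; apply: filtM.
have [|g hg] := @filt_complete u.
  by move=> i; rewrite /u big_ord_recr addrAC subrr add0r.
exists g.
  by have := filtN (hg 1%N); rewrite /u big_ord1 opprB.
apply: filt_separated => N.
have -> : (1 - h) * g - 1 = (1 - h) * (g - u N) - h ^+ N.
  have e : (1 - h) * u N = 1 - h ^+ N.
    by rewrite -[1 - h]opprB mulNr -subrX1 opprB.
  by rewrite mulrBr e opprB -addrA [h ^+ N - 1 - _]addrAC subrr add0r.
by apply: filtB => //; rewrite -[N]add0n; apply: filtM.
Qed.

Lemma unit_sub1 h : filt 1 h -> 1 - h \is a GRing.unit.
Proof.
move=> /filt1_right_inv[g hg e]; have [k _] := filt1_right_inv hg.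
rewrite subKr => e'; apply/unitrP; exists g; split=> //.
by have -> : 1 - h = k by rewrite -[LHS]mulr1 -[X in _ * X]e' mulrA e mul1r.
Qed.

(** Dividing by the constant coefficient leaves a series [1 - h], and [filt 1] asks nothing of the
    coefficients of positive degree. *)
Lemma unit_cf0 f : cf f 0 \is a GRing.unit -> f \is a GRing.unit.
Proof.
move=> u; have uj := rmorph_unit j u.
rewrite -[f](mulVKr uj) -rmorphV // unitrMr //.
rewrite -[X in X \is a _](subKr 1); apply: unit_sub1 => l.
case: l => [|l]; last by rewrite subSS sub0n.
by rewrite cf_B cf_Ml -(expr0 x) cf_x eqxx mulVr // subrr; apply: mpow_0.
Qed.

Lemma max_ideal_filt f : max_ideal f <-> filt 1 f.
Proof.
split; last exact: filt1_nonunit.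
move=> hf [|l]; last by rewrite subSS sub0n.
by apply/(mpow1E hB); apply: contra hf; apply: unit_cf0.
Qed.

Lemma skew_local : local_ring S.
Proof.
split=> [f g /max_ideal_filt hf /max_ideal_filt hg|r f /max_ideal_filt hf].
  by apply/max_ideal_filt/filtD.
split; apply/max_ideal_filt; first exact: (@filtM 0 1).
exact: (@filtM 1 0).
Qed.

Lemma mpow_j N b : mpow B N b -> mpow S N (j b).
Proof.
elim: N b => [//|N IH]; apply: (@mpowS_ind _ (fun b => mpow S N.+1 (j b))).
- by rewrite rmorph0; apply: mpow_0.
- by move=> a b; rewrite rmorphD; apply: mpowD.
move=> a b ha hb; rewrite rmorphM; apply: mpowS_mul; last exact: IH.
apply/max_ideal_filt => l; rewrite cf_j.
by case: eqP => [->|_]; [apply/mpow1E|apply: mpow_0].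
Qed.

(** From right to left, write [f = j b + h * x]: the constant term lies in the required power, [h]
    satisfies the bound of one step lower, and [x] is in the maximal ideal. *)
Lemma mpow_filt N f : mpow S N f <-> filt N f.
Proof.
elim: N f => [//|N IH] f; split.
  apply: (@mpowS_ind _ (filt N.+1)) => [|a b|a b ha hb].
  - exact: filt_0.
  - exact: filtD.
  by rewrite -add1n; apply: filtM; [apply/max_ideal_filt|apply/IH].
move=> hf; have [h hh] := cf_surj (fun l => cf f l.+1).
have -> : f = j (cf f 0) + h * x.
  apply: cf_eq => l; rewrite cf_D cf_j cf_Mx.
  by case: l => [|l]; rewrite ?addr0 ?add0r.
apply: mpowD; first by apply: mpow_j; have := hf 0%N; rewrite subn0.
rewrite -addn1; apply: mpowM; first exact: skew_local.
  by apply/IH => l; rewrite hh; have := hf l.+1; rewrite subSS.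
apply/(mpow1E skew_local)/max_ideal_filt => -[|l]; last by rewrite subSS sub0n.
by rewrite -(expr1 x) cf_x; apply: mpow_0.
Qed.

Lemma skew_complete : adic_complete S.
Proof.
split=> [f hf|u hu].
  by apply: filt_separated => N; rewrite subr0; apply/mpow_filt.
have [|f hf] := @filt_complete u; first by move=> i; apply/mpow_filt.
by exists f => i; apply/mpow_filt.
Qed.

(** Such an [a] commutes with the powers of [x], hence with truncations; continuity in each factor
    does the rest. It is applied to the digits. *)
Lemma skew_central a : (forall b, b * a = a * b) -> sigma a = a -> delta a = 0
  ->
  forall f, f * j a = j a * f.
Proof.
move=> ca sa da f.
have xa l : x ^+ l * j a = j a * x ^+ l.
  elim: l => [|l IH]; first by rewrite mulr1 mul1r.
  by rewrite exprSr -mulrA xj sa da rmorph0 addr0 !mulrA IH.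
apply: filt_separated => N.
have [M' hM'] := mul_trunc_r (j a) f N.
have [M'' hM''] := cf_cont f (j a) N.
have {hM''}/near_filt h1 : near N (f * j a) (trunc f (maxn M' M'') * j a).
  apply: hM''; last exact: near_refl.
  move=> m hm; apply: (mpow_le hB (leq_maxr M' M'')).
  by apply: near_trunc; apply: leq_trans (leq_maxr _ _).
have h2 := hM' _ (leq_maxl M' M'').
have e : trunc f (maxn M' M'') * j a = j a * trunc f (maxn M' M'').
  rewrite /trunc mulr_suml mulr_sumr; apply: eq_bigr => l _.
  by rewrite -mulrA xa !mulrA -!rmorphM ca.
rewrite -[f * _](subrK (j a * trunc f (maxn M' M''))) -{1}e -addrA.
by rewrite -[X in _ + X]opprB; apply: filtB.
Qed.

End SkewPowerSeries.

(** * Digit expansions *)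

Definition upclosed n (U : set 'X_{1..n}) : Prop :=
  forall al be, U al -> U (al + be)%MM.

(* [c r al] is the residue of the coefficient of x^al in r.  In mixed
   characteristic c is not additive, but [digit_sub] says that carries only go
   upwards. *)
Record digit_map (k : fieldType) (R : unitRingType) (tau : k -> R) (n : nat)
    (x : n.-tuple R) (c : R -> 'X_{1..n} -> k) : Prop := DigitMap {
  digit_mpow : forall N r,
    mpow R N r <-> forall al, (mdeg al < N)%N -> c r al = 0;
  digit_surj : forall d, exists r, forall al, c r al = d al;
  digit_sub : forall U, upclosed U -> forall r s,
    (forall al, ~ U al -> c (r - s) al = 0) <->
    (forall al, ~ U al -> c r al = c s al);
  digit_erase : forall r al be,
    c (r - tau (c r al) * xmon x al) be = if be == al then 0 else c r be;
  digit_scale : forall a r al, c (tau a * r) al = a * c r al;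
  digit_central : forall a r, r * tau a = tau a * r }.

(** * Digits in the coefficient ring *)

Section Coefficients.
Context (k : finFieldType) (A : idomainType) (res : {rmorphism A -> k})
        (iota : k -> A) (hiota : mult_section res iota).

Lemma res_iota a : res (iota a) = a.
Proof. by case: hiota => _; apply. Qed.

Lemma iotaM a b : iota (a * b) = iota a * iota b.
Proof. by case: hiota. Qed.

(** Only multiplicativity is available: an idempotent of a domain is 0 or 1, and its residue decides
    which. *)
Lemma iota0 : iota 0 = 0.
Proof.
have /eqP : iota 0 * (iota 0 - 1) = 0 by rewrite mulrBr -iotaM !mulr0 mulr1
  subrr.
rewrite mulf_eq0 => /orP[/eqP //|]; rewrite subr_eq0 => /eqP /(congr1 res).
by rewrite res_iota rmorph1 => /esym/eqP; rewrite oner_eq0.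
Qed.

Lemma iota1 : iota 1 = 1.
Proof.
have /eqP : iota 1 * (iota 1 - 1) = 0 by rewrite mulrBr -iotaM !mulr1 subrr.
rewrite mulf_eq0 subr_eq0 => /orP[|/eqP //] /eqP /(congr1 res).
by rewrite res_iota rmorph0 => /eqP; rewrite oner_eq0.
Qed.

Section Field.
Context (res_bij : bijective res).

Let res_inj : injective res := bij_inj res_bij.

Lemma field_max_ideal (a : A) : max_ideal a <-> a = 0.
Proof.
split=> [|->]; last exact: max_ideal0.
move=> ha; apply: contrapT => /eqP a0; move/negP: ha; apply.
apply/unitrP; exists (iota (res a)^-1).
suff e : iota (res a)^-1 * a = 1 by split; rewrite // mulrC.
apply: res_inj; rewrite rmorphM res_iota rmorph1 mulVf //.
by apply: contra a0 => /eqP h; apply/eqP/res_inj; rewrite h rmorph0.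
Qed.

Lemma field_local : local_ring A.
Proof.
split=> [a b /field_max_ideal -> /field_max_ideal ->|r a /field_max_ideal ->].
  by rewrite addr0; apply: max_ideal0.
by rewrite mulr0 mul0r; split; apply: max_ideal0.
Qed.

Lemma field_mpow N (a : A) : mpow A N.+1 a <-> a = 0.
Proof.
split=> [h|->]; last by apply: mpow_0.
apply/field_max_ideal/(mpow1E field_local).
exact: (mpow_le field_local (ltn0Sn N) h).
Qed.

Lemma field_complete : adic_complete A.
Proof.
split=> [a /(_ 1%N) /field_mpow //|u hu].
have e i : u i.+1 = u 1%N.
  elim: i => // i <-; apply/eqP; rewrite -subr_eq0; apply/eqP.
  by have /field_mpow := hu i.+1.
by exists (u 1%N) => -[//|i]; rewrite e subrr; apply: mpow_0.
Qed.

Lemma field_digit_map (x : 0.-tuple A) : digit_map iota x (fun a _ => res a).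
Proof.
have mnmX (al be : 'X_{1..0}) : al = be by apply/mnmP => -[].
split.
- case=> [//|N] r; split=> [/field_mpow -> al _|h]; first exact: rmorph0.
  apply/field_mpow/res_inj; rewrite rmorph0; apply: (h 0%MM).
  by rewrite mdeg0.
- by move=> d; exists (iota (d 0%MM)) => al; rewrite res_iota (mnmX al 0%MM).
- move=> U _ r s; split=> h al /h; rewrite rmorphB; last by move=> ->;
  rewrite subrr.
  by move=> /eqP; rewrite subr_eq0 => /eqP.
- move=> r al be; rewrite (mnmX be al) eqxx /xmon big_ord0 mulr1.
  by rewrite rmorphB res_iota subrr.
- by move=> a r al; rewrite rmorphM res_iota.
by move=> a r; rewrite mulrC.
Qed.

End Field.

Section Dvr.
Context (x1 : A) (A_dvr : is_dvr A) (A_complete : adic_complete A)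
  (res_max : forall a : A, max_ideal a <-> res a = 0) (x1_unif : uniformiser
    x1).

Lemma dvr_local : local_ring A.
Proof.
case: A_dvr => hD _ _; split=> [//|r a /res_max ha].
by split; apply/res_max; rewrite rmorphM ha ?mulr0 ?mul0r.
Qed.

Lemma unif_max a : max_ideal a <-> exists b, a = b * x1.
Proof. by have -> : max_ideal a = [set b | exists c, b = c * x1] a by rewrite
  -x1_unif. Qed.

Lemma unif_neq0 : x1 != 0.
Proof.
case: A_dvr => _ _ [a a0 /unif_max[c e]]; apply: contra a0 => /eqP x0.
by rewrite e x0 mulr0.
Qed.

Lemma dvr_mpow N (a : A) : mpow A N a <-> exists b, a = b * x1 ^+ N.
Proof.
elim: N a => [|N IH] a; first by split=> // _; exists a; rewrite mulr1.
split=> [|[b ->]].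
  apply: (@mpowS_ind _ (fun a => exists b, a = b * x1 ^+ N.+1)).
  - by exists 0; rewrite mul0r.
  - by move=> _ _ [b ->] [c ->]; exists (b + c); rewrite mulrDl.
  move=> _ _ /unif_max[b ->] /IH[c ->]; exists (b * c).
  by rewrite exprS mulrACA mulrA.
rewrite exprS mulrCA; apply: mpowS_mul; last by apply/IH; exists b.
by apply/unif_max; exists 1; rewrite mul1r.
Qed.

Lemma residue_step a : exists b, a = iota (res a) + b * x1.
Proof.
have /unif_max[b e] : max_ideal (a - iota (res a)).
  by apply/res_max; rewrite rmorphB res_iota subrr.
by exists b; rewrite -e addrC subrK.
Qed.

(** The remainder after one step of the Teichmueller expansion; iterating it produces the digits. *)
Definition shift (a : A) : A := xget 0 [set b | a = iota (res a) + b * x1].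

Lemma shiftE a : a = iota (res a) + shift a * x1.
Proof. by have [b hb] := residue_step a;
  apply: (@xgetI _ 0 [set b | a = iota (res a) + b * x1] b). Qed.

Lemma shift_uniq a c b : a = iota c + b * x1 -> res a = c /\ shift a = b.
Proof.
move=> e; have rx : res x1 = 0 by apply/res_max/unif_max; exists 1;
  rewrite mul1r.
have ra : res a = c by rewrite e rmorphD rmorphM rx mulr0 addr0 res_iota.
split=> //; apply: (mulIf unif_neq0); apply: (addrI (iota c)).
by rewrite -[in RHS]e -ra -shiftE.
Qed.

Fixpoint dvr_digit (i : nat) (a : A) : k :=
  if i is i'.+1 then dvr_digit i' (shift a) else res a.

Lemma dvr_digitS i a b c : a = iota c + b * x1 ->
  dvr_digit i a = if i is i'.+1 then dvr_digit i' b else c.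
Proof. by move=> /shift_uniq[<- <-]; case: i. Qed.

Lemma dvr_digit0 i : dvr_digit i 0 = 0.
Proof.
elim: i => [|i IH]; first exact: rmorph0.
by rewrite (@dvr_digitS _ _ 0 0) // iota0 mul0r addr0.
Qed.

(** With equal residues the Teichmueller parts cancel, so [a - b] is [x1] times the difference of
    the shifts; this drives the induction although digits are not additive. *)
Lemma dvr_digit_eq u a b :
  (forall i, (i < u)%N -> dvr_digit i a = dvr_digit i b) <->
  exists e, a - b = e * x1 ^+ u.
Proof.
elim: u a b => [|u IH] a b.
  by split=> // _; exists (a - b); rewrite mulr1.
have eab : res a = res b -> a - b = (shift a - shift b) * x1.
  move=> e; rewrite {1}(shiftE a) {1}(shiftE b) e mulrBl opprD addrACA subrr.
  by rewrite add0r.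
split=> [h|[e he]].
  have r := h 0%N isT.
  have [e he] := (IH (shift a) (shift b)).1 (fun i => h i.+1).
  by exists e; rewrite eab // he exprSr mulrA.
have r : res a = res b.
  apply/eqP; rewrite -subr_eq0 -rmorphB; apply/eqP/res_max/unif_max.
  by exists (e * x1 ^+ u); rewrite he exprSr mulrA.
case=> [//|i] hi; apply: (IH (shift a) (shift b)).2 i hi; exists e.
by apply: (mulIf unif_neq0); rewrite -eab // he exprSr mulrA.
Qed.

(** Both sides say that [x1 ^+ u] divides [a - b]; the left one compares [a - b] with 0. *)
Lemma dvr_digit_sub u a b :
  (forall i, (i < u)%N -> dvr_digit i (a - b) = 0) <->
  (forall i, (i < u)%N -> dvr_digit i a = dvr_digit i b).
Proof.
rewrite dvr_digit_eq -{2}[a - b]subr0 -dvr_digit_eq.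
by split=> h i hi; rewrite h // dvr_digit0.
Qed.

Lemma dvr_digit_surj (d : nat -> k) : exists a, forall i, dvr_digit i a = d i.
Proof.
pose u (d : nat -> k) N := \sum_(i < N) iota (d i) * x1 ^+ i.
have [|a ha] := A_complete.2 (u d).
  move=> i; rewrite /u big_ord_recr addrAC subrr add0r.
  by apply/dvr_mpow; exists (iota (d i)).
exists a => i; have /dvr_mpow/dvr_digit_eq -> // := ha i.+1.
elim: i {a ha} d => [|i IH] d; rewrite /u big_ord_recl mulr1.
  by rewrite big_ord0 addr0 /= res_iota.
rewrite (@dvr_digitS _ _ (u (fun i => d i.+1) i.+1) (d 0%N)); first exact: IH.
rewrite mulr_suml; congr (_ + _).
by apply: eq_bigr => m _; rewrite exprSr mulrA.
Qed.

Lemma dvr_digit_erase a m i :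
  dvr_digit i (a - iota (dvr_digit m a) * x1 ^+ m) =
  if i == m then 0 else dvr_digit i a.
Proof.
elim: m a i => [|m IH] a i.
  rewrite (@dvr_digitS _ _ (shift a) 0); first by case: i.
  by rewrite {1}(shiftE a) mulr1 iota0 addrAC subrr.
rewrite (@dvr_digitS _ _ (shift a - iota (dvr_digit m (shift a)) * x1 ^+ m)
  (res a)).
  by case: i => [|i] //; rewrite IH.
by rewrite {1}(shiftE a) mulrBl -mulrA -exprSr addrA.
Qed.

Lemma dvr_digit_scale c a i : dvr_digit i (iota c * a) = c * dvr_digit i a.
Proof.
elim: i a => [|i IH] a; first by rewrite /= rmorphM res_iota.
rewrite (@dvr_digitS _ _ (iota c * shift a) (c * res a)) ?IH //.
by rewrite {1}(shiftE a) mulrDr iotaM mulrA.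
Qed.

Lemma dvr_digit_map (x : 1.-tuple A) : tval x = [:: x1] ->
  digit_map iota x (fun a al => dvr_digit (al ord0) a).
Proof.
move=> ex; have deg (al : 'X_{1..1}) : mdeg al = al ord0.
  by rewrite mdegE big_ord1.
pose mon i : 'X_{1..1} := [multinom i | _ < 1].
have monE i : mon i ord0 = i by rewrite mnmE.
have monK (al : 'X_{1..1}) : mon (al ord0) = al by apply/mnmP => i;
  rewrite mnmE (ord1 i).
have xm (al : 'X_{1..1}) : xmon x al = x1 ^+ al ord0.
  by rewrite /xmon big_ord1 (tnth_nth 0) ex.
split.
- move=> N r; rewrite dvr_mpow -[in X in X <-> _](subr0 r) -dvr_digit_eq.
  split=> h => [al|i hi]; first by rewrite deg => /h; rewrite dvr_digit0.
  by have := h (mon i); rewrite deg monE dvr_digit0; apply.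
- move=> d; have [a ha] := dvr_digit_surj (fun i => d (mon i)).
  by exists a => al; rewrite ha monK.
(* In one variable the complement of [U] is an initial segment, so comparing the first
   [(al ord0).+1] digits is enough. *)
- move=> U hU r s; have hlow (al : 'X_{1..1}) i : ~ U al -> (i < (al
  ord0).+1)%N -> ~ U (mon i).
    rewrite ltnS => + /subnK e hi; apply.
    rewrite -(monK al) -e;
      have -> : mon (al ord0 - i + i)%N = (mon i + mon (al ord0 - i)%N)%MM.
      by apply/mnmP => l; rewrite mnmDE !mnmE addnC.
    exact: hU.
  split=> h al hal; have hl i := hlow al i hal.
    apply: (dvr_digit_sub (al ord0).+1 r s).1 => // i hi.
    by have := h _ (hl i hi); rewrite monE.
  apply: (dvr_digit_sub (al ord0).+1 r s).2 => // i hi.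
  by have := h _ (hl i hi); rewrite monE.
- move=> r al be; rewrite xm dvr_digit_erase; congr (if _ then _ else _).
  by apply/eqP/eqP => [e|-> //]; rewrite -(monK be) e monK.
- by move=> a r al; rewrite dvr_digit_scale.
by move=> a r; rewrite mulrC.
Qed.

End Dvr.

End Coefficients.

(** * Splitting off the exponent of the last variable *)

Section SplitMonomial.
Context (n : nat).
Implicit Types (al be : 'X_{1..n.+1}) (ga de : 'X_{1..n}).

Definition mlow al : 'X_{1..n} := [multinom al (lift ord_max i) | i < n].

Definition mjoin ga (l : nat) : 'X_{1..n.+1} :=
  [multinom if unlift ord_max i is Some i' then ga i' else l | i < n.+1].

Lemma mjoin_low ga l : mlow (mjoin ga l) = ga.
Proof. by apply/mnmP => i; rewrite !mnmE liftK. Qed.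

Lemma mjoin_max ga l : mjoin ga l ord_max = l.
Proof. by rewrite mnmE unlift_none. Qed.

Lemma mjoinK al : mjoin (mlow al) (al ord_max) = al.
Proof. by apply/mnmP => i; rewrite mnmE; case: unliftP => [i'|] ->;
  rewrite ?mnmE. Qed.

Lemma mjoinD ga l de m :
  mjoin (ga + de)%MM (l + m) = (mjoin ga l + mjoin de m)%MM.
Proof.
by apply/mnmP => i; rewrite mnmDE !mnmE; case: unlift => [i'|//]; rewrite mnmDE.
Qed.

Lemma widen_lift_max (i : 'I_n) : widen_ord (leqnSn n) i = lift ord_max i.
Proof. by apply: val_inj; rewrite -[RHS]/(nat_of_ord (lift _ _)) lift_max. Qed.

Lemma mdeg_split al : mdeg al = (mdeg (mlow al) + al ord_max)%N.
Proof.
rewrite !mdegE big_ord_recr; congr (_ + _)%N.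
by apply: eq_bigr => i _; rewrite mnmE widen_lift_max.
Qed.

Lemma xmon_split (B S : unitRingType) (j : {rmorphism B -> S}) (x : S)
    (u : n.-tuple B) (t : n.+1.-tuple S) al :
  tval t = rcons (map j u) x -> xmon t al = j (xmon u (mlow al)) * x ^+ al
    ord_max.
Proof.
move=> et; rewrite /xmon big_ord_recr rmorph_prod; congr (_ * _ ^+ _).
  apply: eq_bigr => i _; rewrite widen_lift_max mnmE rmorphXn; congr (_ ^+ _).
  rewrite !(tnth_nth 0) et nth_rcons size_map size_tuple lift_max ltn_ord.
  by rewrite (nth_map 0) ?size_tuple.
by rewrite (tnth_nth 0) et nth_rcons size_map size_tuple ltnn eqxx.
Qed.

End SplitMonomial.

(** The digits of a series are those of its coefficients, with the degree in [x] as last exponent.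
    Total degree is right because the [N]-th power of the maximal ideal bounds the coefficient of
    degree [l] by the power [N - l]. *)
Lemma skew_digit_map (k : fieldType) (B S : unitRingType) (tau : k -> B)
    (sigma : {rmorphism B -> B}) (delta : {additive B -> B})
    (j : {rmorphism B -> S}) (x : S) n (u : n.-tuple B) (t : n.+1.-tuple S) c :
  local_ring B -> adic_complete B -> local_skew_derivation sigma delta ->
  (forall a, sigma (tau a) = tau a /\ delta (tau a) = 0) ->
  skew_power_series j x sigma delta -> tval t = rcons (map j u) x ->
  digit_map tau u c ->
  [/\ local_ring S, adic_complete S & exists c', digit_map (j \o tau) t c'].
Proof.
move=> hB cB hsd htau [cf [[cf_inj cf_surj] cf_lin cf_x xj cf_cont]] et.
case=> [c_mpow c_surj c_sub c_erase c_scale c_central].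
have hS := skew_local hB cB hsd cf_inj cf_surj cf_lin cf_x xj cf_cont.
have cS := skew_complete hB cB hsd cf_inj cf_surj cf_lin cf_x xj cf_cont.
have mS := mpow_filt hB cB hsd cf_inj cf_surj cf_lin cf_x xj cf_cont.
split=> //; exists (fun f (al : 'X_{1..n.+1}) => c (cf f (al ord_max)) (mlow
  al)); split.
- move=> N f; rewrite mS; split=> h.
    move=> al; rewrite mdeg_split => hal; apply: (c_mpow _ _).1 (h _) _ _.
    by rewrite ltn_subRL addnC.
  move=> l; apply/c_mpow => al hal.
  have := h (mjoin al l); rewrite mdeg_split mjoin_low mjoin_max; apply.
  by rewrite addnC -ltn_subRL.
- move=> d; have /choice[b hb] l := c_surj (fun al => d (mjoin al l)).
  by have [f hf] := cf_surj b; exists f => al; rewrite hf hb mjoinK.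
(* Subtraction is coefficientwise and each slice of [U] at a fixed last exponent is again upward
   closed, so carries are controlled inside B. *)
- move=> U hU f g; pose V l : set _ := fun al => U (mjoin al l).
  have hV l : upclosed (V l).
    by move=> al be h; rewrite /V -[l]addn0 mjoinD; apply: hU.
  split=> h al hal.
    apply: (c_sub _ (hV (al ord_max)) _ _).1; last by rewrite /V mjoinK.
    move=> be hbe; have := h _ hbe.
    by rewrite mjoin_low mjoin_max (cf_B cf_lin).
  rewrite (cf_B cf_lin).
  apply: (c_sub _ (hV (al ord_max)) _ _).2; last by rewrite /V mjoinK.
  by move=> be hbe; have := h _ hbe; rewrite mjoin_low mjoin_max.
- move=> f al be; rewrite (xmon_split al et) /= mulrA -rmorphM.
  rewrite (cf_B cf_lin) (cf_jx cf_lin cf_x).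
  case: (be ord_max =P al ord_max) => [e|ne]; last first.
    by rewrite subr0; case: eqP => // e; case: ne; rewrite e.
  rewrite e c_erase; congr (if _ then _ else _).
  by apply/eqP/eqP => [el|-> //]; rewrite -(mjoinK be) el e mjoinK.
- by move=> a f al; rewrite (cf_Ml cf_lin).
move=> a f; have [sa da] := htau a.
exact: (skew_central hB cB cf_inj cf_lin cf_x xj cf_cont (c_central a) sa da f).
Qed.

Theorem iterated_digit_map (k : finFieldType) (A : idomainType)
    (res : {rmorphism A -> k}) (xs0 : seq A) (iota : k -> A)
    (R : unitRingType) (eta : {rmorphism A -> R}) (xs : seq R) :
  coefficient_ring res xs0 -> mult_section res iota ->
  iterated_skew_power_series xs0 eta xs ->
  [/\ local_ring R, adic_complete R & forall n (t : n.-tuple R), tval t = xs ->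
    exists c, digit_map (eta \o iota) t c].
Proof.
move=> hA hiota; elim=> [|B eta' us sigma delta S j x _ [hB cB IH] hsd hlin hS].
  case: hA => [hres|x1 A_dvr cA _ _ hmax hx1].
    split=> [||n t et]; [exact: field_local hiota _|exact: field_complete hiota
      _|].
    have e : n = 0%N by rewrite -(size_tuple t) et.
    by subst n; exists (fun a _ => res a); apply: field_digit_map.
  split=> // [|n t et]; first exact: dvr_local A_dvr hmax.
  have e : n = 1%N by rewrite -(size_tuple t) et.
  subst n; exists (fun a (al : 'X_{1..1}) => dvr_digit res iota x1 (al ord0) a).
  exact: dvr_digit_map.
have [c hc] := IH _ (in_tuple us) erefl.
pose t : (size us).+1.-tuple S := [tuple of rcons (map j (in_tuple us)) x].
have ht a : sigma ((eta' \o iota) a) = (eta' \o iota) a /\ delta ((eta' \o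
  iota) a) = 0.
  exact: hlin.
have [lS cS _] := @skew_digit_map _ _ _ _ _ _ _ _ _ (in_tuple us) t _ hB cB hsd
  ht hS erefl hc.
split=> // n t' et'.
have e : n = (size us).+1 by rewrite -(size_tuple t') et' size_rcons size_map.
subst n.
by have [_ _] := @skew_digit_map _ _ _ _ _ _ _ _ _ (in_tuple us) t' _ hB cB hsd
  ht hS et' hc.
Qed.

(** * Compactness of [M -> K] for [M] countable and [K] finite *)

(** Koenig's argument: a partial choice is persistent if every [P j] contains a point agreeing with
    it. Persistence can be kept while fixing one more coordinate, and the limit of these choices
    lies in each [P j] by closedness. *)
Lemma chain_compact (K : finType) (M : countType) (J : Type)
    (P : J -> set (M -> K)) (j0 : J) :
  (forall i j, P i `<=` P j \/ P j `<=` P i) ->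
  (forall j, exists e, P j e) ->
  (forall j e, (forall L : seq M, exists2 e', P j e' & {in L, e =1 e'}) -> P j
    e) ->
  exists e, forall j, P j e.
Proof.
move=> hchain hne hclosed.
pose agree N (e e' : M -> K) := forall m, (pickle m < N)%N -> e m = e' m.
pose persistent N e := forall j, exists2 e', P j e' & agree N e e'.
have extend N e : persistent N e -> exists2 e', persistent N.+1 e' & agree N e'
  e.
  (* [N] need not be the code of an element; in that case there is nothing to choose. *)
  move=> he; case: (pselect (exists m : M, pickle m = N)) => [[m hm]|hN];
    last first.
    exists e => // j; have [e' he' ee'] := he j; exists e' => // m.
    rewrite ltnS leq_eqVlt => /orP[/eqP hm|]; last by apply: ee'.
    by case: hN; exists m.
  pose upd v m' := if m' == m then v else e m'.
  suff [v hv] : exists v, persistent N.+1 (upd v).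
    exists (upd v) => // m'; rewrite /upd; case: eqP => // ->.
    by rewrite hm ltnn.
  apply: contrapT => hno.
  have /choice[jv hjv] v : exists j, forall e', P j e' -> ~ agree N.+1 (upd v)
    e'.
    apply: contrapT => h; apply: hno; exists v => j; apply: contrapT => hj.
    by apply: h; exists j => e' he' ha; apply: hj; exists e'.
  (* Finitely many values and a chain give one set below all the excluding ones. A witness in it
     takes some value at [m], and the index excluding that value yields the contradiction. *)
  have [j hj] : exists j, forall v, v \in enum K -> P j `<=` P (jv v).
    elim: (enum K) => [|v s [j hj]]; first by exists j0.
    case: (hchain j (jv v)) => h.
      by exists j => w; rewrite inE => /orP[/eqP ->|/hj].
    exists (jv v) => w; rewrite inE => /orP[/eqP -> //|/hj h'].
    exact: subset_trans h h'.
  have [e' he' ee'] := he j.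
  apply: (hjv (e' m)) (hj _ _ _ he') _; first by rewrite mem_enum.
  move=> m'; rewrite ltnS leq_eqVlt /upd; case: (m' =P m) => [-> //|ne].
  move=> /orP[/eqP hm'|]; last by apply: ee'.
  case: ne; apply: (pcan_inj pickleK).
  by rewrite hm' hm.
have /choice[next hnext] (Ne : nat * (M -> K)) : exists e',
    persistent Ne.1 Ne.2 -> persistent Ne.1.+1 e' /\ agree Ne.1 e' Ne.2.
  case: (pselect (persistent Ne.1 Ne.2)) => [/extend[e' h1 h2]|h].
    by exists e'.
  by exists Ne.2 => /h.
have [e0 _] := hne j0.
pose es := fix es N := if N is N'.+1 then next (N', es N') else e0.
have hes N : persistent N (es N).
  elim: N => [|N IH]; first by move=> j; have [e he] := hne j; exists e.
  exact: (hnext (N, es N) IH).1.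
have stable m N : (pickle m < N)%N -> es N m = es (pickle m).+1 m.
  move=> /subnK <-; elim: (N - _)%N => [//|d IH].
  rewrite addSn -IH; apply: (hnext (_, es _) (hes _)).2.
  by rewrite addnS ltnS leq_addl.
exists (fun m => es (pickle m).+1 m) => j; apply: hclosed => L.
have [e he ee] := hes (\max_(m <- L) (pickle m).+1) j; exists e => // m hm.
have lt_m : (pickle m < \max_(m <- L) (pickle m).+1)%N.
  elim: L {e he ee} hm => [//|a L IH]; rewrite inE big_cons leq_max.
  by move=> /orP[/eqP ->|/IH ->]; rewrite ?leqnn ?orbT.
by rewrite -ee // stable.
Qed.

(** * Dickson's lemma *)

(** Induction on the number of variables. Lifts of a finite basis of the projection handle every [t]
    whose last exponent is at least the bound [M] of the lifts; the finitely many slices below [M]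
    have finite bases of their own. *)
Lemma dickson n (T : set 'X_{1..n}) : exists L : seq 'X_{1..n},
  (forall l, l \in L -> T l) /\
  forall t, T t -> exists2 l, l \in L & (l <= t)%MM.
Proof.
elim: n T => [|n IH] T.
  case: (pselect (T 0%MM)) => h0.
    exists [:: 0%MM]; split=> [l|t _]; first by rewrite inE => /eqP ->.
    by exists 0%MM; rewrite ?mem_head //; apply/mnm_lepP => -[].
  exists [::]; split=> // t ht; case: h0.
  by have <- : t = 0%MM by apply/mnmP => -[].
have [L' [hL' hlow]] := IH [set a | exists2 t, T t & mlow t = a].
have /choice[up hup] a : exists t, a \in L' -> T t /\ mlow t = a.
  case: (boolP (a \in L')) => [/hL'[t ht e]|_]; last by exists 0%MM.
  by exists t.
have /choice[Ls hLs] m := IH [set a | T (mjoin a m)].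
pose M := \max_(l <- L') up l ord_max.
exists ([seq up l | l <- L'] ++
        flatten [seq [seq mjoin a m | a <- Ls m] | m <- iota 0 M]).
split=> [l|t ht].
  rewrite mem_cat => /orP[/mapP[a /hup[ha _] -> //]|].
  by move=> /flatten_mapP[m _ /mapP[a /(hLs m).1 ha ->]].
case: (ltnP (t ord_max) M) => hM.
  have [|l hl le_lt] := (hLs (t ord_max)).2 (mlow t);
    first by rewrite /= mjoinK.
  exists (mjoin l (t ord_max)).
    rewrite mem_cat; apply/orP; right; apply/flatten_mapP; exists (t ord_max).
      by rewrite mem_iota.
    by apply/mapP; exists l.
  apply/mnm_lepP => i; case: (unliftP ord_max i) => [i'|] ->.
    by move/mnm_lepP: le_lt => /(_ i'); rewrite !mnmE liftK.
  by rewrite mjoin_max.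
have [|l hl le_lt] := hlow (mlow t); first by exists t.
exists (up l); first by rewrite mem_cat map_f.
have [_ el] := hup l hl.
apply/mnm_lepP => i; case: (unliftP ord_max i) => [i'|] ->.
  by move/mnm_lepP: le_lt => /(_ i'); rewrite -{1}el !mnmE.
apply: leq_trans hM; rewrite /M; elim: (L') hl => [//|a s IHs].
rewrite inE big_cons leq_max => /orP[/eqP -> |/IHs ->]; rewrite ?leqnn ?orbT //.
Qed.

(** * Leading monomials *)

Section LeadingMonomial.
Context (k : finFieldType) (R : unitRingType) (tau : k -> R)
        (n : nat) (x : n.-tuple R) (c : R -> 'X_{1..n} -> k)
        (hR : local_ring R) (cR : adic_complete R) (hc : digit_map tau x c)
        (tau0 : tau 0 = 0) (tau1 : tau 1 = 1)
        (tauM : {morph tau : a b / a * b}).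

Local Notation X := 'X_{1..n}.
Local Notation mon := (xmon x).

Lemma digit0 al : c 0 al = 0.
Proof. by have := digit_scale hc 0 0 al; rewrite tau0 !mul0r. Qed.

Lemma digit_inj r s : (forall al, c r al = c s al) -> r = s.
Proof.
move=> h; apply: (adic_separated cR) => N.
apply/(digit_mpow hc) => al _.
apply: (digit_sub hc (U := set0) _ r s).2 => //.
Qed.

Lemma digit_monom a al be : c (tau a * mon al) be = if be == al then a else 0.
Proof.
have [s hs] := digit_surj hc (fun be => if be == al then a else 0).
suff -> : tau a * mon al = s by [].
apply/esym/eqP; rewrite -subr_eq0; apply/eqP/digit_inj => ga.
have := digit_erase hc s al ga; rewrite hs eqxx => ->.
by rewrite digit0 hs; case: eqP.
Qed.

(** This is [digit_erase] read backwards: erasing the digit at [al] from the element with the wanted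
    digits gives back [r]. Filling an empty place causes no carry. *)
Lemma digit_add_monom r a al be : c r al = 0 ->
  c (r + tau a * mon al) be = if be == al then a else c r be.
Proof.
move=> h; have [s hs] := digit_surj hc (fun be => if be == al then a else c r
  be).
suff -> : r + tau a * mon al = s by [].
apply/esym/eqP; rewrite -subr_eq; apply/eqP/digit_inj => ga.
have := digit_erase hc s al ga; rewrite hs eqxx => ->.
by rewrite hs; case: eqP => // ->.
Qed.

Definition monoms (N : nat) : seq X := [seq bmnm m | m : 'X_{1..n < N}].

Lemma mem_monoms N al : (al \in monoms N) = (mdeg al < N)%N.
Proof.
apply/mapP/idP => [[m _ ->]|h]; first exact: bmdeg.
by exists (BMultinom h); rewrite ?mem_enum.
Qed.

Lemma uniq_monoms N : uniq (monoms N).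
Proof. by rewrite map_inj_uniq ?enum_uniq //; apply: val_inj. Qed.

Lemma digit_erase_seq r (F : seq X) be : uniq F ->
  c (r - \sum_(al <- F) tau (c r al) * mon al) be =
  if be \in F then 0 else c r be.
Proof.
elim: F be => [|al F IH] be; first by rewrite big_nil subr0.
move=> /andP[alF uF]; rewrite big_cons opprD addrA addrAC.
set d := r - _; have e : c d al = c r al by rewrite IH // (negPf alF).
rewrite -e (digit_erase hc) inE; case: eqP => //= _; exact: IH.
Qed.

Lemma expansion_digits r : expansion tau x r (fun al => tau (c r al)).
Proof.
split=> [al|N]; first by exists (c r al).
exists (monoms N) => F uF sF; apply/(digit_mpow hc) => al hal.
by rewrite digit_erase_seq // sF // mem_monoms.
Qed.

Lemma upclosed_mdeg N : upclosed [set al : X | (N <= mdeg al)%N].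
Proof. by move=> al be h; rewrite /= mdegD;
  apply: leq_trans h (leq_addr _ _). Qed.

Lemma digit_cong N r s al :
  mpow R N (r - s) -> (mdeg al < N)%N -> c r al = c s al.
Proof.
move=> /(digit_mpow hc) h hal.
apply: (digit_sub hc (@upclosed_mdeg N) r s).1; last by rewrite /= leqNgt hal.
by move=> be /= /negP; rewrite -ltnNge => /h.
Qed.

(** [coef] picks some expansion, so this amounts to uniqueness: the chosen digits define an [s],
    which is shown to be congruent to [r] modulo a power beyond the degree of [al]. *)
Lemma coefE r al : coef tau x r al = tau (c r al).
Proof.
have : expansion tau x r (coef tau x r).
  exact: (@xgetI _ (fun=> 0) [set d | expansion tau x r d] _ (expansion_digits
    r)).
case=> hrange; have /choice[e he] be : exists a, tau a = coef tau x r be.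
  by have [a _ ha] := hrange be; exists a.
move=> hs; rewrite -he; congr tau.
have [s es] := digit_surj hc e.
have [F0 hF] := hs (mdeg al).+1.
(* [F0] makes the partial sum close to [r], and the monomials of low degree make it close to [s]. *)
have := hF (undup (F0 ++ monoms (mdeg al).+1)) (undup_uniq _).
set F := undup _; have sF : {subset F0 <= F}.
  by move=> be hbe; rewrite mem_undup mem_cat hbe.
move=> /(_ sF) h1; have uF : uniq F by apply: undup_uniq.
rewrite -es; apply/esym; apply: (@digit_cong (mdeg al).+1) => //.
rewrite -[r](subrK (\sum_(be <- F) coef tau x r be * mon be)) -addrA.
apply: mpowD => //; apply/(digit_mpow hc) => be hbe.
rewrite -[_ - s]opprB; under eq_bigr do rewrite -he -es.
have : mpow R (mdeg al).+1 (s - \sum_(al <- F) tau (c s al) * mon al).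
  apply/(digit_mpow hc) => ga hga; rewrite digit_erase_seq //.
  by rewrite mem_undup mem_cat mem_monoms hga orbT.
by move=> /(mpowN hR)/(digit_mpow hc); apply.
Qed.

Lemma tau_eq0 a : (tau a == 0) = (a == 0).
Proof.
case: (a =P 0) => [->|/eqP a0]; first by rewrite tau0 eqxx.
apply/eqP => e; have /eqP := tau1; rewrite -(mulfV a0) tauM e mul0r.
by rewrite eq_sym oner_eq0.
Qed.

Lemma suppE r al : supp tau x r al <-> c r al != 0.
Proof. by rewrite /supp /= coefE tau_eq0. Qed.

Lemma tau_unit a : a != 0 -> tau a \is a GRing.unit.
Proof.
by move=> a0; apply/unitrP; exists (tau a^-1); rewrite -!tauM mulVf // mulfV.
Qed.

Lemma tauV a : a != 0 -> (tau a)^-1 = tau a^-1.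
Proof.
by move=> a0; apply: (mulrI (tau_unit a0));
  rewrite mulrV ?tau_unit // -tauM mulfV.
Qed.

Definition supported (U : set X) (r : R) : Prop := forall al, ~ U al -> c r al
  = 0.

Lemma supported0 U : supported U 0.
Proof. by move=> al _; apply: digit0. Qed.

Lemma supportedW (U V : set X) r : U `<=` V -> supported U r -> supported V r.
Proof. by move=> UV h al hal; apply: h => /UV. Qed.

Lemma supported_scale U a r : supported U r -> supported U (tau a * r).
Proof. by move=> h al /h e; rewrite (digit_scale hc) e mulr0. Qed.

Lemma supported_sub U r s : upclosed U ->
  supported U (r - s) <-> (forall al, ~ U al -> c r al = c s al).
Proof. by move=> hU; apply: (digit_sub hc hU). Qed.

Lemma supportedB U r s : upclosed U ->
  supported U r -> supported U s -> supported U (r - s).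
Proof.
by move=> hU hr hs; apply/supported_sub => // al hal; rewrite hr // hs.
Qed.

Lemma supportedN U r : upclosed U -> supported U r -> supported U (- r).
Proof. by move=> hU hr; rewrite -sub0r; apply: supportedB => //;
  apply: supported0. Qed.

Lemma supportedD U r s : upclosed U ->
  supported U r -> supported U s -> supported U (r + s).
Proof. by move=> hU hr hs; rewrite -[s]opprK; apply: supportedB => //;
  apply: supportedN. Qed.

Lemma supported_sum U (T : Type) (s : seq T) (P : pred T) (F : T -> R) :
  upclosed U -> (forall t, P t -> supported U (F t)) ->
  supported U (\sum_(t <- s | P t) F t).
Proof.
move=> hU hF; apply: big_ind => //; first exact: supported0.
by move=> r t; apply: supportedD.
Qed.

Lemma supported_closed U r :
  (forall N, exists2 s, supported U s & mpow R N (r - s)) -> supported U r.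
Proof.
move=> h al hal; have [s hs hrs] := h (mdeg al).+1.
by rewrite (digit_cong hrs) // hs.
Qed.

Context (le : rel X) (hle : monomial_order tau x le).

Local Notation lt := (prec le).
Local Notation LM := (LM tau x le).

Lemma le_refl al : le al al.
Proof. by case: hle => -[[h _ _ _] _ _] _; apply: h. Qed.

Lemma le_trans be al ga : le al be -> le be ga -> le al ga.
Proof. by case: hle => -[[_ _ h _] _ _] _; apply: h. Qed.

Lemma le_anti al be : le al be -> le be al -> al = be.
Proof. by case: hle => -[[_ h _ _] _ _] _ h1 h2; apply: h; rewrite h1 h2. Qed.

Lemma le_total al be : le al be || le be al.
Proof. by case: hle => -[[_ _ _ h] _ _] _; apply: h. Qed.

Lemma lt_irr al : ~~ lt al al.
Proof. by rewrite /prec eqxx. Qed.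

Lemma lt_le al be : lt al be -> le al be.
Proof. by case/andP. Qed.

Lemma le_eqVlt al be : le al be = (al == be) || lt al be.
Proof. by rewrite /prec; case: eqP => //= ->; rewrite le_refl. Qed.

Lemma leNlt al be : le al be = ~~ lt be al.
Proof.
rewrite /prec negb_and negbK; case: eqP => [->|ne] /=; first exact: le_refl.
by apply/idP/negP => [h1 h2|h]; [case: ne;
  apply: le_anti|case/orP: (le_total al be)].
Qed.

Lemma lt_le_trans be al ga : lt al be -> le be ga -> lt al ga.
Proof.
move=> /andP[ne h1] h2; rewrite /prec (le_trans h1 h2) andbT.
by apply: contra ne => /eqP e; rewrite (le_anti h1) // e.
Qed.

Lemma le_lt_trans be al ga : le al be -> lt be ga -> lt al ga.
Proof.
move=> h1 /andP[ne h2]; rewrite /prec (le_trans h1 h2) andbT.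
by apply: contra ne => /eqP e; rewrite (le_anti h2) // -e.
Qed.

Lemma lt_add2r ga al be : lt (al + ga)%MM (be + ga)%MM = lt al be.
Proof.
case: hle => -[_ _ hadd] _; apply/idP/idP => [|/hadd //].
apply: contraTT; rewrite -!leNlt le_eqVlt => /orP[/eqP ->|/hadd/lt_le //].
exact: le_refl.
Qed.

Lemma le_add2r ga al be : le (al + ga)%MM (be + ga)%MM = le al be.
Proof. by rewrite !leNlt lt_add2r. Qed.

Lemma le_addr al be : le al (al + be)%MM.
Proof.
rewrite -{1}(add0m al) [(al + be)%MM]addmC le_add2r le_eqVlt eq_sym.
by case: eqP => //= /eqP be0; case: hle => -[_ h _] _; apply: h.
Qed.

Lemma lem_le al be : (al <= be)%MM -> le al be.
Proof. by move=> /submK <-; rewrite addmC; apply: le_addr. Qed.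

Lemma exists_le_min (T : set X) : (exists t, T t) ->
  exists2 m, T m & forall t, T t -> le m t.
Proof.
move=> [t0 ht0]; have [L [hL hT]] := dickson T.
have [l0 hl0 _] := hT t0 ht0.
suff [m hm hmin] : exists2 m, m \in L & forall l, l \in L -> le m l.
  exists m; first exact: hL.
  by move=> t /hT[l /hmin h /lem_le]; apply: le_trans.
elim: L l0 hl0 {hL hT} => [//|a [|b s] IH] _ _.
  exists a; first exact: mem_head.
  by move=> l; rewrite inE => /eqP ->; apply: le_refl.
have [m hm hmin] := IH b (mem_head _ _).
case/orP: (le_total a m) => h.
  exists a; first exact: mem_head.
  move=> l; rewrite inE => /orP[/eqP ->|/hmin]; first exact: le_refl.
  exact: le_trans.
exists m; first by rewrite inE hm orbT.
by move=> l; rewrite inE => /orP[/eqP ->|/hmin].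
Qed.

Lemma lt_wf : well_founded (fun al be => lt al be).
Proof.
move=> al; apply: contrapT => hal.
have [|m hm hmin] := @exists_le_min [set a | ~ Acc (fun al be => lt al be) a].
  by exists al.
apply: hm; constructor=> be hbe; apply: contrapT => /hmin.
by rewrite leNlt hbe.
Qed.

Definition above (ga : X) : set X := [set al | le ga al].
Definition sabove (ga : X) : set X := [set al | lt ga al].

Lemma above_up ga : upclosed (above ga).
Proof. by move=> al be /le_trans; apply; apply: le_addr. Qed.

Lemma sabove_up ga : upclosed (sabove ga).
Proof. by move=> al be /lt_le_trans; apply; apply: le_addr. Qed.

Lemma sabove_sub ga : sabove ga `<=` above ga.
Proof. by move=> al; apply: lt_le. Qed.

Lemma neq0_digit r : r != 0 -> exists al, c r al != 0.
Proof.
move=> r0; apply: contrapT => h; move/eqP: r0; apply; apply: digit_inj => al.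
by rewrite digit0; apply/eqP; apply: contrapT => /negP h'; apply: h; exists al.
Qed.

Lemma LMP r : r != 0 -> c r (LM r) != 0 /\ supported (above (LM r)) r.
Proof.
move=> /neq0_digit/exists_le_min[m hm hmin].
have [] : [set al | supp tau x r al /\ forall be, supp tau x r be -> le al be]
  (LM r).
  apply: (@xgetI _ 0%MM _ m); split; first exact/suppE.
  by move=> be /suppE; apply: hmin.
move=> /suppE h1 h2; split=> // al hal; apply/eqP; apply: contrapT => /negP h.
by apply: hal; apply: h2; apply/suppE.
Qed.

Lemma supported_sabove ga r :
  supported (sabove ga) r <-> supported (above ga) r /\ c r ga = 0.
Proof.
split=> [h|[h e] al /negP hal].
  by split; [apply: supportedW h; apply: sabove_sub|apply: h;
    apply/negP/lt_irr].
case: (al =P ga) => [->//|/eqP ne]; apply: h => /= h'.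
by move: hal; rewrite /sabove /= /prec eq_sym ne h'.
Qed.

Lemma LM_eq r al : supported (above al) r -> c r al != 0 -> r != 0 /\ LM r = al.
Proof.
move=> h h0; have r0 : r != 0 by apply: contra h0 => /eqP ->; rewrite digit0.
split=> //; have [h1 h2] := LMP r0; apply: le_anti.
  by apply: contrapT => /h2 e; rewrite e eqxx in h0.
by apply: contrapT => /h e; rewrite e eqxx in h1.
Qed.

Lemma LCE r : LC tau x le r = tau (c r (LM r)).
Proof. exact: coefE. Qed.

(** The monomial order speaks only of [LM], whose default on the zero element is 0. A vanishing
    product would force both exponents to be 0, where the product is 1. *)
Lemma mon_mul_neq0 al be : mon al * mon be != 0.
Proof.
have LM0 : LM 0 = 0%MM.
  by apply: xgetPN => ga [/suppE]; rewrite digit0 eqxx.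
apply/eqP => e; have := hle.2 al be; rewrite e LM0 => /esym e0.
have [al0 be0] : al = 0%MM /\ be = 0%MM.
  split; apply/mnmP => i; move/mnmP: e0 => /(_ i); rewrite mnmDE mnm0E => /eqP;
  by rewrite addn_eq0 => /andP[/eqP + /eqP].
have mon0 : mon 0%MM = 1.
  by rewrite /xmon big1 // => i _; rewrite mnm0E.
by move/eqP: e; rewrite al0 be0 mon0 mulr1 oner_eq0.
Qed.

Definition lead_coef2 al be : k := c (mon al * mon be) (al + be)%MM.

Lemma mon_mul al be :
  lead_coef2 al be != 0 /\ supported (above (al + be)%MM) (mon al * mon be).
Proof. by have := LMP (mon_mul_neq0 al be); rewrite hle.2. Qed.

(** Modulo each power of the maximal ideal both factors are finite sums of monomials with central
    digits, so the claim reduces to products of two monomials. *)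
Lemma supported_mul U V W f g : upclosed U ->
  (forall a b, V a -> W b -> above (a + b)%MM `<=` U) ->
  supported V f -> supported W g -> supported U (f * g).
Proof.
move=> hU hVW hf hg; apply: supported_closed => N.
pose tr h := \sum_(al <- monoms N) tau (c h al) * mon al.
have htr h : mpow R N (h - tr h).
  apply/(digit_mpow hc) => al hal.
  by rewrite digit_erase_seq ?uniq_monoms // mem_monoms hal.
exists (tr f * tr g); last first.
  have -> : f * g - tr f * tr g = (f - tr f) * g + tr f * (g - tr g).
    by rewrite mulrBl mulrBr addrA subrK.
  by apply: mpowD; [apply: mpowMr|apply: mpowMl].
rewrite /tr mulr_suml; apply: supported_sum => // a _.
rewrite mulr_sumr; apply: supported_sum => // b _.
rewrite mulrA -[X in X * _]mulrA (digit_central hc) -!mulrA.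
case: (pselect (V a)) => [Va|/hf ->]; last first.
  by rewrite tau0 mul0r; apply: supported0.
case: (pselect (W b)) => [Wb|/hg ->]; last first.
  by rewrite tau0 mul0r mulr0; apply: supported0.
do 2!apply: supported_scale.
by apply: supportedW (mon_mul a b).2; apply: hVW.
Qed.

Lemma le_lt_add al be ga de : le al ga -> lt be de -> lt (al + be)%MM (ga +
  de)%MM.
Proof.
move=> h1 h2; apply: (@le_lt_trans (ga + be)%MM); first by rewrite le_add2r.
by rewrite ![(ga + _)%MM]addmC lt_add2r.
Qed.

Lemma lt_le_add al be ga de : lt al ga -> le be de -> lt (al + be)%MM (ga +
  de)%MM.
Proof. by move=> h1 h2; rewrite ![(_ + be)%MM]addmC ![(ga + _)%MM]addmC;
  apply: le_lt_add. Qed.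

Lemma le_add al be ga de : le al ga -> le be de -> le (al + be)%MM (ga + de)%MM.
Proof.
move=> h1 h2; apply: (@le_trans (ga + be)%MM); first by rewrite le_add2r.
by rewrite ![(ga + _)%MM]addmC le_add2r.
Qed.

Lemma supported_mul_above al be f g :
  supported (above al) f -> supported (above be) g ->
  supported (above (al + be)%MM) (f * g).
Proof.
apply: supported_mul => [|a b ha hb ga]; first exact: above_up.
by apply: le_trans; apply: le_add.
Qed.

Lemma supported_mul_sabovel al be f g :
  supported (sabove al) f -> supported (above be) g ->
  supported (sabove (al + be)%MM) (f * g).
Proof.
apply: supported_mul => [|a b ha hb ga]; first exact: sabove_up.
by apply: lt_le_trans; apply: lt_le_add.
Qed.

Lemma supported_mul_sabover al be f g :
  supported (above al) f -> supported (sabove be) g ->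
  supported (sabove (al + be)%MM) (f * g).
Proof.
apply: supported_mul => [|a b ha hb ga]; first exact: sabove_up.
by apply: lt_le_trans; apply: le_lt_add.
Qed.

Lemma supported_tail al f : supported (above al) f ->
  supported (sabove al) (f - tau (c f al) * mon al).
Proof.
move=> h; apply/supported_sabove; split; last by rewrite (digit_erase hc) eqxx.
by move=> be hbe; rewrite (digit_erase hc); case: eqP => // _; apply: h.
Qed.

Lemma supported_mon al : supported (above al) (mon al).
Proof.
rewrite -[mon al]mul1r -tau1 => be hbe; rewrite digit_monom.
by case: eqP => // e; case: hbe; rewrite e; apply: le_refl.
Qed.

(** Replacing each factor by its lowest term alters the product only strictly above [al + be], which
    leaves the digit there untouched. *)
Lemma digit_mul al be f g :
  supported (above al) f -> supported (above be) g ->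
  c (f * g) (al + be)%MM = c f al * c g be * lead_coef2 al be.
Proof.
move=> hf hg; rewrite /lead_coef2 -(digit_scale hc) tauM.
have hU := @sabove_up (al + be)%MM.
apply: (supported_sub _ _ hU).1; last exact/negP/lt_irr.
have -> : f * g - tau (c f al) * tau (c g be) * (mon al * mon be) =
  (f - tau (c f al) * mon al) * g +
  tau (c f al) * (mon al * (g - tau (c g be) * mon be)).
  rewrite mulrBl mulrBr mulrA mulrBr !mulrA addrA subrK.
  rewrite -[tau (c f al) * mon al * tau _]mulrA.
  by rewrite (digit_central hc _ (mon al)) !mulrA.
apply: supportedD => //.
  by apply: supported_mul_sabovel => //; apply: supported_tail.
apply: supported_scale; apply: supported_mul_sabover;
  last exact: supported_tail.
exact: supported_mon.
Qed.

Lemma LM_mul f g : f != 0 -> g != 0 ->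
  f * g != 0 /\ LM (f * g) = (LM f + LM g)%MM.
Proof.
move=> /LMP[f0 hf] /LMP[g0 hg]; apply: LM_eq; first exact: supported_mul_above.
by rewrite digit_mul // !mulf_neq0 // (mon_mul _ _).1.
Qed.

Lemma digit_mon al : c (mon al) al = 1.
Proof. by rewrite -[mon al]mul1r -tau1 digit_monom eqxx. Qed.

Lemma LM_mon al : mon al != 0 /\ LM (mon al) = al.
Proof.
by apply: LM_eq; [apply: supported_mon|rewrite digit_mon oner_neq0].
Qed.

(** * Division *)

Definition order_up (U : set X) : Prop := forall al be, U al -> le al be -> U
  be.

Lemma above_order_up ga : order_up (above ga).
Proof. by move=> al be; apply: le_trans. Qed.

Lemma sabove_order_up ga : order_up (sabove ga).
Proof. by move=> al be; apply: lt_le_trans. Qed.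

Lemma order_up_upclosed U : order_up U -> upclosed U.
Proof. by move=> hU al be /hU; apply; apply: le_addr. Qed.

(** Exponents allowed in a cofactor of an element with leading exponent [ga] when the product is to
    stay in [U]. *)
Definition pull (U : set X) (ga : X) : set X := [set al | U (al + ga)%MM].

Lemma pull_upclosed U ga : upclosed U -> upclosed (pull U ga).
Proof.
move=> hU al be h; rewrite /pull /=.
have -> : (al + be + ga = al + ga + be)%MM by rewrite -!addmA [(be +
  ga)%MM]addmC.
exact: hU.
Qed.

Lemma supported_mul_pull U q g : order_up U -> g != 0 ->
  supported (pull U (LM g)) q -> supported U (q * g).
Proof.
move=> hU g0 hq; apply: supported_mul hq (LMP g0).2.
  exact: order_up_upclosed.
move=> a b ha hb ga hga; apply: hU ha _; apply: le_trans hga.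
by apply: le_add; first exact: le_refl.
Qed.

Definition undigit (d : X -> k) : R := xget 0 [set r | forall al, c r al = d
  al].

Lemma digit_undigit d al : c (undigit d) al = d al.
Proof.
have [r hr] := digit_surj hc d.
exact: (@xgetI _ 0 [set r | forall al, c r al = d al] r hr).
Qed.

Lemma lt_recursion (F : X -> (X -> k) -> k) :
  exists e, forall de, e de = F de (fun al => if lt al de then e al else 0).
Proof.
pose rec_step de (rec : forall al, lt al de -> k) :=
  F de (fun al => if pselect (lt al de) is left h then rec al h else 0).
exists (Fix lt_wf (fun _ => k) rec_step) => de; rewrite Fix_eq.
  rewrite /rec_step; congr (F de _); apply: funext => al.
  by case: pselect => [->|/negP/negPf ->].
move=> al f g h; rewrite /rec_step; congr (F al _); apply: funext => be.
by case: pselect.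
Qed.

Section Division.
Context (T : finType) (g : T -> R) (g0 : forall t, g t != 0).

(* No two of the products q t * g t have leading terms that could cancel. *)
Definition separated (q : T -> R) : Prop := forall t t' al be,
  c (q t) al != 0 -> c (q t') be != 0 ->
  (al + LM (g t) = be + LM (g t'))%MM -> t = t'.

(** The least exponent [al + LM (g t)] is reached for a single [t]; all other products lie strictly
    above it and cannot cancel its digit. *)
Lemma separated_lead q t0 al0 : separated q -> c (q t0) al0 != 0 ->
  exists t al, [/\ \sum_t q t * g t != 0,
    LM (\sum_t q t * g t) = (al + LM (g t))%MM
    & forall t' be, c (q t') be != 0 ->
        le (al + LM (g t))%MM (be + LM (g t'))%MM].
Proof.
move=> hq hq0.
have [|m [t [al [h0 em]]] hmin] := @exists_le_min
    [set m | exists t al, c (q t) al != 0 /\ m = (al + LM (g t))%MM].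
  by exists (al0 + LM (g t0))%MM, t0, al0.
exists t, al; rewrite -em.
suff [? ?] : \sum_t q t * g t != 0 /\ LM (\sum_t q t * g t) = m.
  by split=> // t' be hbe; apply: hmin; exists t', be.
have hab t' : supported (pull (above m) (LM (g t'))) (q t').
  move=> be hbe; apply/eqP; apply: contrapT => /negP h; apply: hbe.
  by apply: hmin; exists t', be.
apply: LM_eq.
  apply: supported_sum => [|t' _]; first exact: above_up.
  by apply: supported_mul_pull => //; apply: above_order_up.
have [g1 g2] := LMP (g0 t).
have qa : supported (above al) (q t).
  by move=> be hbe; apply: hab; rewrite /pull /above /= em le_add2r.
rewrite (bigD1 t) //= addrC; set r := \sum_(_ | _) _.
have hr : supported (sabove m) r.
  apply: supported_sum => [|t' ht']; first exact: sabove_up.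
  apply: supported_mul_pull => //; first exact: sabove_order_up.
  move=> be /negP hbe; apply/eqP; apply: contrapT => /negP h; move/negP: hbe;
    apply.
  rewrite /pull /sabove /= /prec; apply/andP; split; last by apply: hmin;
    exists t', be.
  by apply: contra ht' => /eqP e; apply/eqP/(hq _ _ _ _ h h0); rewrite -em.
have -> : c (r + q t * g t) m = c (q t * g t) m.
  apply: (supported_sub (U := sabove m) _ _ _).1;
    [exact: sabove_up| |exact/negP/lt_irr].
  by rewrite addrK.
by rewrite em digit_mul // !mulf_neq0 // (mon_mul _ _).1.
Qed.

Lemma separated_supported U q : order_up U -> separated q ->
  supported U (\sum_t q t * g t) -> forall t, supported (pull U (LM (g t))) (q
    t).
Proof.
move=> hU hq hs t al hal; apply/eqP; apply: contrapT => /negP h0.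
have [t' [be [s0 e hmin]]] := separated_lead hq h0.
have [h1 _] := LMP s0; apply: hal; apply: hU (hmin _ _ h0); rewrite -e.
by apply: contrapT => /hs e'; rewrite e' eqxx in h1.
Qed.

Lemma separated_LM q : separated q -> \sum_t q t * g t != 0 ->
  exists t, (LM (g t) <= LM (\sum_t q t * g t))%MM.
Proof.
move=> hq s0; apply: contrapT => h; move/eqP: s0; apply; apply: big1 => t _.
suff -> : q t = 0 by rewrite mul0r.
apply: digit_inj => al; rewrite digit0; apply/eqP; apply: contrapT => /negP h0.
have [t' [be [_ e _]]] := separated_lead hq h0.
by apply: h; exists t'; rewrite e lem_addl.
Qed.

Context (sel : X -> T) (hsel : forall al t, sel al = t -> (LM (g t) <= al)%MM).

Definition standard (q : T -> R) : Prop :=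
  forall t al, c (q t) al != 0 -> sel (al + LM (g t))%MM = t.

(** Every exponent is assigned by [sel] to exactly one divisor, so one function [e] on exponents
    encodes all quotients simultaneously. *)
Let quo (e : X -> k) (t : T) : R := undigit
  (fun al => if sel (al + LM (g t))%MM == t then e (al + LM (g t))%MM else 0).

Let comb (e : X -> k) : R := \sum_t quo e t * g t.

Let comb_sub U e e' : order_up U -> (forall al, ~ U al -> e al = e' al) ->
  supported U (comb e - comb e').
Proof.
move=> hU h; have uU := order_up_upclosed hU.
rewrite /comb -sumrB; apply: supported_sum => // t _.
rewrite -mulrBl; apply: supported_mul_pull => //.
apply/supported_sub => [|al hal]; first exact: pull_upclosed.
by rewrite !digit_undigit; case: eqP => // _; apply: h.
Qed.

Let unit_at de : R := mon (de - LM (g (sel de)))%MM * g (sel de).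

Let unit_atP de : supported (above de) (unit_at de) /\ c (unit_at de) de != 0.
Proof.
have [h1 h2] := LMP (g0 (sel de)).
have e := submK (hsel (erefl (sel de))); rewrite /unit_at; split.
  rewrite -{1}e; apply: supported_mul_above => //; exact: supported_mon.
rewrite -[X in c _ X]e digit_mul //; last exact: supported_mon.
by rewrite digit_mon mul1r mulf_neq0 // (mon_mul _ _).1.
Qed.

Let comb_step e de :
  comb (fun al => if le al de then e al else 0) =
  comb (fun al => if lt al de then e al else 0) + tau (e de) * unit_at de.
Proof.
have h := submK (hsel (erefl (sel de))).
rewrite /comb (bigD1 (sel de)) //= [in RHS](bigD1 (sel de)) //= addrAC.
congr (_ + _).
  rewrite /unit_at mulrA -mulrDl; congr (_ * _); apply: digit_inj => al.
  rewrite digit_add_monom ?digit_undigit; last first.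
    by rewrite h eqxx (negPf (lt_irr de)).
  case: (al =P (de - _)%MM) => [->|ne]; first by rewrite h eqxx le_refl.
  case: eqP => // _; rewrite le_eqVlt; case: eqP => //= e'.
  by case: ne; rewrite -[X in (X - _)%MM]e' addmK.
apply: eq_bigr => t ht; congr (_ * _); apply: digit_inj => al.
rewrite !digit_undigit; case: eqP => // et; rewrite le_eqVlt.
by case: eqP => //= e'; rewrite -et e' eqxx in ht.
Qed.

(* Transfinite recursion along the well-order [le] determines the coefficients
   of the quotients; unlike for polynomials, [le] need not be of type omega. *)
Theorem division f : exists2 q, standard q & f = \sum_t q t * g t.
Proof.
(* The digit that cancels what the part built so far leaves at [de]; the divisor appears because
   [unit_at de] need not have leading digit 1. *)
pose F de e := c (f - comb e) de / c (unit_at de) de.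
have [e he] := lt_recursion F.
pose el de al := if lt al de then e al else 0.
pose ee de al := if le al de then e al else 0.
have step de : supported (above de) (f - comb (el de)) ->
    supported (sabove de) (f - comb (ee de)).
  move=> h; have [u1 u2] := unit_atP de.
  rewrite /ee comb_step opprD addrA; apply/supported_sub;
    first exact: sabove_up.
  move=> al hal; rewrite (digit_scale hc).
  case: (al =P de) => [->|/eqP ne]; first by rewrite he divfK.
  have hal' : ~ above de al.
    by move=> h'; apply: hal; rewrite /sabove /= /prec eq_sym ne.
  by rewrite h // u1 // mulr0.
(* Limit exponents need no separate case: for [al] below [de], the combinations cut before [de] and
   just after [al] agree up to [al], and the latter already matches [f] there. *)
have low de : supported (above de) (f - comb (el de)).
  elim/(well_founded_ind lt_wf): de => de IH al /negP;
    rewrite leNlt negbK => hal.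
  have -> : f - comb (el de) =
      (f - comb (ee al)) - (comb (el de) - comb (ee al)) by rewrite opprB addrA
        subrK.
  have : ~ sabove al al by apply/negP/lt_irr.
  apply: supportedB; first exact: sabove_up.
    by apply: step; apply: IH.
  apply: comb_sub => [|be]; first exact: sabove_order_up.
  move=> /negP; rewrite /= -leNlt /el /ee => h; rewrite h.
  by rewrite (le_lt_trans h hal).
exists (quo e) => [t al|].
  rewrite digit_undigit; case: (sel (al + LM (g t))%MM =P t) => // _.
  by rewrite eqxx.
apply/eqP; rewrite -subr_eq0; apply/eqP/digit_inj => al; rewrite digit0.
have -> : f - \sum_t quo e t * g t =
    (f - comb (ee al)) - (comb e - comb (ee al)) by rewrite opprB addrA subrK.
have : ~ sabove al al by apply/negP/lt_irr.
apply: supportedB; [exact: sabove_up|exact: step|].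
apply: comb_sub => [|be]; first exact: sabove_order_up.
by move=> /negP; rewrite /= -leNlt /ee => ->.
Qed.

End Division.

(** * Buchberger's criterion *)

Section Buchberger.
Context (s : nat) (G : s.-tuple R) (G0 : forall i, tnth G i != 0).

Local Notation g := (tnth G).
Local Notation D := (Delta tau x le G).

Lemma upset1 (ga al : X) : upset [set ga] al <-> (ga <= al)%MM.
Proof.
split=> [[_ [be [-> ->]]]|h]; first exact: lem_addr.
by exists ga, (al - ga)%MM; rewrite addmC submK.
Qed.

Lemma DeltasP (used : set X) (Gs : seq R) i al : (i < size Gs)%N ->
  nth set0 (Deltas tau x le used Gs) i al <->
  [/\ (LM (nth 0%R Gs i) <= al)%MM, ~ used al
    & forall j, (j < i)%N -> ~ (LM (nth 0%R Gs j) <= al)%MM].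
Proof.
elim: Gs used i => [//|a Gs IH] used [|i] /= hi.
  by split=> [[/upset1 ? ?]|[? ? _]]; [split|split=> //; apply/upset1].
rewrite IH //; split=> [[h1 h2 h3]|[h1 h2 h3]].
  split=> // [h|[|j] hj]; [by apply: h2; left| |exact: h3].
  by move=> /upset1 h; apply: h2; case: (pselect (used al)) => hu; [left|right].
split=> // [[//|[/upset1 h _]]|j hj]; [exact: (h3 0%N)|exact: (h3 j.+1)].
Qed.

Lemma DeltaP i al : D i al <->
  (LM (g i) <= al)%MM /\ forall j : 'I_s, (j < i)%N -> ~ (LM (g j) <= al)%MM.
Proof.
rewrite /Delta DeltasP ?size_tuple // -tnth_nth; split=> [[h1 _ h2]|[h1 h2]].
  by split=> // j /h2; rewrite -tnth_nth.
split=> // j hj; have hjs := ltn_trans hj (ltn_ord i).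
by have := h2 (Ordinal hjs) hj; rewrite (tnth_nth 0).
Qed.

Lemma Delta_dvd i al : D i al -> (LM (g i) <= al)%MM.
Proof. by case/DeltaP. Qed.

Lemma Delta_uniq i j al : D i al -> D j al -> i = j.
Proof.
move=> /DeltaP[hi hi'] /DeltaP[hj hj']; apply: val_inj.
by case: (ltngtP i j) => // [/hj'|/hi'].
Qed.

Lemma Delta_ex i al : (LM (g i) <= al)%MM -> exists j, D j al.
Proof.
move=> h; case: (@arg_minnP _ i (fun j => (LM (g j) <= al)%MM) val h) => j hj
  hmin.
exists j; apply/DeltaP; split=> // l lt_lj /hmin.
by rewrite leqNgt lt_lj.
Qed.

Definition admissible (q : 'I_s -> R) : Prop :=
  forall i al, c (q i) al != 0 -> D i (al + LM (g i))%MM.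

Definition select (al : X) : option 'I_s := [pick i | `[< D i al >]].

Lemma selectP al i : select al = Some i <-> D i al.
Proof.
rewrite /select; case: pickP => [j /asboolP hj|h].
  by split=> [[<-]|/(Delta_uniq hj) ->].
by split=> // /asboolP; rewrite h.
Qed.

(** The remainder is the quotient by an extra divisor 1, indexed by [None], which receives the
    exponents outside all Delta sets. Division with remainder becomes exact division. *)
Let g1 (t : option 'I_s) : R := if t is Some i then g i else 1.

Let LM1 : LM 1 = 0%MM.
Proof.
have <- : mon 0%MM = 1 by rewrite /xmon big1 // => i _; rewrite mnm0E.
by case: (LM_mon 0%MM).
Qed.

Let g1_neq0 t : g1 t != 0.
Proof. by case: t => [i|] //=; rewrite oner_neq0. Qed.

Let select_dvd al t : select al = t -> (LM (g1 t) <= al)%MM.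
Proof.
case: t => [i /selectP/Delta_dvd //|_].
by rewrite /g1 LM1 -[al]add0m lem_addr.
Qed.

Lemma sum_option (F : option 'I_s -> R) :
  \sum_t F t = F None + \sum_(i < s) F (Some i).
Proof.
rewrite (bigD1 None) //=; congr (_ + _).
rewrite (reindex_omap Some id) /=; first by apply: eq_bigl => i; rewrite eqxx.
by case.
Qed.

Lemma right_division_exists f : exists r q, right_division tau x le G f q r.
Proof.
have [q hq ->] := division g1_neq0 select_dvd f.
exists (q None), (fun i => q (Some i));
  split=> [|i al /suppE h|al /suppE h i hi].
- by rewrite sum_option /= mulr1 addrC.
- by apply/selectP/(hq (Some i)).
have := hq None al h; rewrite /= LM1 addm0 => e.
by have /selectP := hi; rewrite e.
Qed.

Lemma remainderP f : exists q, right_division tau x le G f q (remainder tau x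
  le G f).
Proof.
have [r [q h]] := right_division_exists f.
by apply: (@xgetI _ f [set r | exists q, right_division tau x le G f q r] r);
  exists q.
Qed.

Lemma admissible_separated q : admissible q -> separated g q.
Proof. by move=> hq i j al be /hq hi /hq + e; rewrite -e;
  apply: Delta_uniq. Qed.

Lemma monic_multiple f m : f != 0 -> (LM f <= m)%MM ->
  let xf := mon (m - LM f)%MM * f in
  exists u, [/\ u != 0, xf / LC tau x le xf = tau u * xf,
    supported (above m) (tau u * xf) & c (tau u * xf) m = 1].
Proof.
move=> f0 hm xf; have [xf0 exf] : xf != 0 /\ LM xf = m.
  have [m0 em] := LM_mon (m - LM f)%MM; have [h e] := LM_mul m0 f0.
  by split=> //; rewrite e em submK.
have [c0 hxf] := LMP xf0; rewrite exf in c0 hxf.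
exists (c xf m)^-1; split; first by rewrite invr_eq0.
- by rewrite LCE exf tauV // (digit_central hc).
- exact: supported_scale.
by rewrite (digit_scale hc) mulVf.
Qed.

(** Both multiples are normalised to digit 1 at [m], so their difference starts strictly above. That
    [u] is nonzero allows solving for the first multiple later. *)
Lemma SelemE f f' : f != 0 -> f' != 0 -> let m := mlcm (LM f) (LM f') in
  exists u v, [/\ u != 0, Selem tau x le f f' =
      tau u * (mon (m - LM f)%MM * f) - tau v * (mon (m - LM f')%MM * f')
    & supported (sabove m) (Selem tau x le f f')].
Proof.
move=> f0 f0' m.
have [u [u0 eu hu cu]] := monic_multiple f0 (lem_mlcml (LM f) (LM f')).
have [v [v0 ev hv cv]] := monic_multiple f0' (lem_mlcmr (LM f) (LM f')).
exists u, v; rewrite /Selem /= eu ev; split=> //.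
apply/supported_sub => [|al hal]; first exact: sabove_up.
case: (al =P m) => [->|/eqP ne]; first by rewrite cu cv.
have hal' : ~ above m al by move=> h; apply: hal;
  rewrite /sabove /= /prec eq_sym ne.
by rewrite hu // hv.
Qed.

(** * Admissible representations when the S-elements reduce to zero *)

Section Criterion.
Context (hS : forall i j, exists2 q, admissible q &
  Selem tau x le (g i) (g j) = \sum_l q l * g l).

(** Multiply the relation for the S-element by [mon mu], with [mu = de - m], and solve for
    [mon a * g i]. The product [mon mu * mon (m - LM (g i))] is [tau lc * mon a] only up to a higher
    [rho], which is subtracted at index [i]. *)
Lemma rewrite_monomial i j a de : (a + LM (g i))%MM = de -> (LM (g j) <= de)%MM
  ->
  exists w : 'I_s -> R, [/\ mon a * g i = \sum_l w l * g l,
    forall l, l != j -> supported (pull (sabove de) (LM (g l))) (w l)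
    & supported (pull (above de) (LM (g j))) (w j)].
Proof.
move=> ea hj; set m := mlcm (LM (g i)) (LM (g j)).
have hm : (m <= de)%MM by rewrite lem_mlcm hj -ea lem_addl.
set mu := (de - m)%MM; have emu : (mu + m)%MM = de by rewrite /mu submK.
have hi : (LM (g i) <= m)%MM := lem_mlcml _ _.
have hj' : (LM (g j) <= m)%MM := lem_mlcmr _ _.
have eai : a = (mu + (m - LM (g i)))%MM.
  by apply: (@addIm _ (LM (g i))); rewrite ea -addmA submK.
have [q hq eq] := hS i j.
have [u [v [u0 eS hsup]]] := SelemE (G0 i) (G0 j); rewrite -/m in eS hsup.
(* An admissible combination has no cancellation at its lowest exponent, so the strict bound on the
   S-element passes to each of its terms. *)
have hql l : supported (pull (sabove m) (LM (g l))) (q l).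
  apply: (separated_supported G0 (@sabove_order_up m) (admissible_separated
    hq)).
  by rewrite -eq.
have [lc0 hmm] := mon_mul mu (m - LM (g i))%MM; rewrite -eai in hmm.
set lc := lead_coef2 _ _ in lc0.
set rho := mon mu * mon (m - LM (g i))%MM - tau lc * mon a.
have hrho : supported (sabove a) rho.
  by rewrite /rho /lc /lead_coef2 -eai; apply: supported_tail.
pose w l := tau lc^-1 * (tau u^-1 *
    (mon mu * (q l + if l == j then tau v * mon (m - LM (g j))%MM else 0))
  - if l == i then rho else 0).
have sumif (i0 : 'I_s) (r : R) : \sum_l (if l == i0 then r else 0) * g l = r *
  g i0.
  rewrite (bigD1 i0) //= eqxx big1 ?addr0 // => l /negPf ->.
  by rewrite mul0r.
have hpull l (V : set X) : order_up V -> upclosed (pull V (LM (g l))).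
  by move=> hV; exact: (pull_upclosed (order_up_upclosed hV)).
have up1 l : upclosed (pull (sabove de) (LM (g l))).
  exact: hpull (@sabove_order_up de).
have up2 l : upclosed (pull (above de) (LM (g l))).
  exact: hpull (@above_order_up de).
have hmq l : supported (pull (sabove de) (LM (g l))) (mon mu * q l).
  apply: supported_mul (@supported_mon mu) (hql l) => // al be ha hb ga hga.
  rewrite /pull /sabove /= -emu.
  by apply: lt_le_trans (le_lt_add ha hb) _; rewrite addmA le_add2r.
have hr l : supported (pull (sabove de) (LM (g l))) (if l == i then rho else 0).
  case: eqP => [->|_]; last exact: supported0.
  apply: supportedW hrho => al hal.
  by rewrite /pull /sabove /= -ea lt_add2r.
exists w; split.
- rewrite /w; under eq_bigr => l _ do
    rewrite -!mulrA mulrBl -!mulrA mulrDl.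
  rewrite -mulr_sumr sumrB -!mulr_sumr big_split /= !sumif -eq eS -mulrA subrK.
  have -> : mon mu * (tau u * (mon (m - LM (g i))%MM * g i)) =
      tau u * (mon mu * mon (m - LM (g i))%MM * g i).
    by rewrite mulrA (digit_central hc) -!mulrA.
  rewrite [tau u^-1 * _]mulrA -tauM mulVf // tau1 mul1r -mulrBl /rho subKr.
  by rewrite !mulrA -tauM mulVf // tau1 mul1r.
- move=> l lj; rewrite /w (negPf lj) addr0; apply: supported_scale.
  by apply: supportedB => //; apply: supported_scale.
rewrite /w eqxx; apply: supported_scale.
have hsub l : pull (sabove de) (LM (g l)) `<=` pull (above de) (LM (g l)).
  by move=> al; apply: lt_le.
apply: supportedB => //; last by apply: supportedW (hr j).
apply: supported_scale; rewrite mulrDr; apply: supportedD => //.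
  by apply: supportedW (hmq j).
rewrite mulrA (digit_central hc) -mulrA; apply: supported_scale.
apply: supportedW (mon_mul _ _).2 => al hal.
rewrite /pull /above /= -emu.
by rewrite -(submK hj') addmA le_add2r.
Qed.

(* The least level at which h is not admissible is repaired by rewriting the
   offending terms with S-elements, which otherwise changes h only at
   higher levels. *)
Lemma improve h : ~ admissible h -> exists de h',
  [/\ exists i al, [/\ c (h i) al != 0, (al + LM (g i))%MM = de & ~ D i de],
    \sum_i h' i * g i = \sum_i h i * g i
    & forall i al, c (h' i) al != 0 -> le (al + LM (g i))%MM de ->
        D i (al + LM (g i))%MM].
Proof.
move=> hbad.
have [|de [i0 [a0 [h0 e0 n0]]] hmin] := @exists_le_min [set de | exists i al,
    [/\ c (h i) al != 0, (al + LM (g i))%MM = de & ~ D i de]].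
  apply: contrapT => hno; apply: hbad => i al hal; apply: contrapT => hD.
  by apply: hno; exists (al + LM (g i))%MM, i, al.
have [j hj] : exists j, D j de by apply: (@Delta_ex i0); rewrite -e0 lem_addl.
have good i al : c (h i) al != 0 -> lt (al + LM (g i))%MM de -> D i (al + LM (g
  i))%MM.
  move=> hal hlt; apply: contrapT => hD; move: hlt; apply/negP; rewrite -leNlt.
  by apply: hmin; exists i, al.
pose a i := (de - LM (g i))%MM.
(* Only the Delta set of [j] contains [de], so the inadmissible terms at this level are those of the
   other indices, and all are removed at once. The divisibility guard excludes indices where the
   truncated difference [a i] is meaningless. *)
pose v i := if (i != j) && (LM (g i) <= de)%MM then c (h i) (a i) else 0.
have /choice[w hw] i : exists w : 'I_s -> R, (LM (g i) <= de)%MM ->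
    [/\ mon (a i) * g i = \sum_l w l * g l,
      forall l, l != j -> supported (pull (sabove de) (LM (g l))) (w l)
      & supported (pull (above de) (LM (g j))) (w j)].
  case: (boolP (LM (g i) <= de)%MM) => [hi|_]; last by exists (fun=> 0).
  have [w hw] := rewrite_monomial (submK hi) (Delta_dvd hj).
  by exists w.
pose corr l := \sum_i tau (v i) * w i l.
pose h' l := h l - tau (v l) * mon (a l) + corr l.
have hcorr l U : upclosed U ->
    (forall i, (LM (g i) <= de)%MM -> supported U (w i l)) -> supported U (corr
      l).
  move=> hU hs; apply: supported_sum => // i _; rewrite /v.
  case: ifP => [/andP[_ /hs]|_]; first exact: supported_scale.
  by rewrite tau0 mul0r; apply: supported0.
exists de, h'; split; first by exists i0, a0.
  rewrite /h'; under eq_bigr do rewrite mulrDl mulrBl.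
  rewrite big_split sumrB /=; set t := \sum_i _ * mon _ * _.
  suff -> : \sum_l corr l * g l = t by rewrite subrK.
  rewrite /t /corr; under eq_bigr do rewrite mulr_suml.
  rewrite exchange_big /=; apply: eq_bigr => i _.
  under eq_bigr do rewrite -mulrA; rewrite -mulr_sumr -mulrA /v.
  case: ifP => [/andP[_ /hw[-> _ _]] //|_].
  by rewrite tau0 !mul0r.
move=> l al hal hle'.
have up1 : upclosed (pull (sabove de) (LM (g l))).
  by apply: pull_upclosed; apply: sabove_up.
have up2 : upclosed (pull (above de) (LM (g l))).
  by apply: pull_upclosed; apply: above_up.
case: ((al + LM (g l))%MM =P de) => [ede|/eqP ne].
  rewrite ede; case: (eqVneq l j) => [-> //|lj].
  move: hal; suff -> : c (h' l) al = 0 by rewrite eqxx.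
  have hl : (LM (g l) <= de)%MM by rewrite -ede lem_addl.
  have -> : c (h' l) al = c (h l - tau (v l) * mon (a l)) al.
    apply: ((supported_sub _ _ up1).1); last first.
      by rewrite /pull /sabove /= ede; apply/negP/lt_irr.
    rewrite /h' [_ + corr l]addrC addrK; apply: hcorr => // i hi.
    by have [_ hw' _] := hw i hi; apply: hw'.
  have -> : al = a l by rewrite /a -ede addmK.
  by rewrite /v lj hl (digit_erase hc) eqxx.
have hlt : lt (al + LM (g l))%MM de by rewrite /prec ne.
apply: good => //; move: hal; suff -> : c (h' l) al = c (h l) al by [].
apply: ((supported_sub _ _ up2).1); last first.
  by rewrite /pull /above /= leNlt hlt.
have -> : h' l - h l = corr l - tau (v l) * mon (a l).
  by rewrite /h' -[h l - _ + _]addrA [h l + _]addrC addrK addrC.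
apply: supportedB => //.
  apply: hcorr => // i hi; have [_ hw1 hw2] := hw i hi.
  case: (eqVneq l j) => [-> //|lj].
  by apply: supportedW (hw1 l lj) => be; apply: lt_le.
rewrite /v; case: ifP => [/andP[_ hl]|_]; last by rewrite tau0 mul0r;
  apply: supported0.
apply: supported_scale; apply: supportedW (@supported_mon (a l)) => be hbe.
by rewrite /pull /above /= -(submK hl) le_add2r.
Qed.

(** The sets [good de] shrink as [de] grows in the total order. Keeping only the levels where they
    are nonempty, compactness gives a point common to all. Were it inadmissible, [improve] would
    make [good de] nonempty at a level where this very point has a bad term. *)
Theorem admissible_representation h : exists2 q, admissible q &
  \sum_i q i * g i = \sum_i h i * g i.
Proof.
case: (pselect (admissible h)) => [ha|hbad]; first by exists h.
pose rep (e : 'I_s * X -> k) i := undigit (fun al => e (i, al)).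
pose good de e := \sum_i rep e i * g i = \sum_i h i * g i /\
  forall i al, e (i, al) != 0 -> le (al + LM (g i))%MM de -> D i (al + LM (g
    i))%MM.
have rep_good de h' : \sum_i h' i * g i = \sum_i h i * g i ->
    (forall i al, c (h' i) al != 0 -> le (al + LM (g i))%MM de ->
      D i (al + LM (g i))%MM) -> good de (fun p => c (h' p.1) p.2).
  move=> e1 e2; split=> //; rewrite -e1; apply: eq_bigr => i _; congr (_ * _).
  by apply: digit_inj => al; rewrite digit_undigit.
have [de0 [h0 [_ hs0 hg0]]] := improve hbad.
pose J := {de : X | exists e, good de e}.
have j0 : J by exists de0; eexists; apply: rep_good hs0 hg0.
have [] := @chain_compact k _ J (fun j => good (sval j)) j0.
- move=> i j; have mono de de' : le de de' -> good de' `<=` good de.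
    by move=> hle' e [e1 e2]; split=> // l al h1 h2; apply: e2 => //;
      apply: le_trans hle'.
  by case/orP: (le_total (sval i) (sval j)) => /mono; [right|left].
- by move=> j; apply: (svalP j).
(* Closedness: admissibility of one term reads a single digit, and the represented element modulo
   the [N]-th power depends only on digits of degree below [N]. *)
- move=> [de hde] e hcl /=; split=> [|i al hal]; last first.
    have [e' [_ he'] ee'] := hcl [:: (i, al)].
    by apply: he'; rewrite -ee' // mem_head.
  apply: (adic_separated cR) => N.
  have [e' [he' _] ee'] := hcl [seq (i, al) | i <- enum 'I_s, al <- monoms N].
  rewrite -he' -sumrB; apply: mpow_sum => i _; rewrite -mulrBl;
    apply: mpowMr => //.
  apply/(digit_mpow hc) => al hal.
  apply: (digit_sub hc (@upclosed_mdeg N) _ _).2; last by rewrite /= leqNgt hal.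
  move=> be /= /negP; rewrite -ltnNge => hbe; rewrite !digit_undigit ee' //.
  by apply: allpairs_f; rewrite ?mem_enum ?mem_monoms.
move=> e he; have [es _] := he j0; exists (rep e) => //.
apply: contrapT => /improve[de [h' [[i [al [hal ede hD]]] hs hg]]].
have hj : exists e, good de e by eexists; apply: rep_good hg; rewrite hs.
have [_ good_e] := he (exist _ de hj); apply: hD; rewrite -ede; apply: good_e.
  by rewrite digit_undigit in hal.
by rewrite /= ede le_refl.
Qed.

End Criterion.

Lemma admissible_LM q : admissible q -> \sum_i q i * g i != 0 ->
  exists i, (LM (g i) <= LM (\sum_i q i * g i))%MM.
Proof. by move=> /admissible_separated hq; apply: separated_LM. Qed.

(** A nonzero remainder of an S-element would lie in [I] with leading exponent outside all Delta
    sets, hence divisible by no [LM (g l)]. Conversely, an admissible representation cannot lose its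
    lowest exponent by cancellation. *)
Theorem groebner_basisP (I : set R) : left_ideal I ->
    left_ideal_basis I G ->
  groebner_basis tau x le I G <->
  forall i j, remainder tau x le G (Selem tau x le (g i) (g j)) = 0.
Proof.
move=> [I0 ID IM] hG; have IG i : I (g i) by case: (hG.1 i).
have Isum (q : 'I_s -> R) : I (\sum_i q i * g i).
  by apply: (big_ind I) => // i _; apply: IM.
have upsetG al : upset (LMset tau x le [set f | f \in tval G]) al <->
    exists i, (LM (g i) <= al)%MM.
  split=> [[_ [be [[f [/tnthP[i ->] _ ->]] ->]]]|[i hi]].
    by exists i; apply: lem_addr.
  exists (LM (g i)), (al - LM (g i))%MM; rewrite addmC submK //; split=> //.
  by exists (g i); split=> //; apply: mem_tnth.
have Isub a b : I a -> I b -> I (a - b).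
  by move=> ha hb; rewrite -mulN1r; apply: ID; last exact: IM.
split=> [[_ hLM] i j|hrem].
  have [u [v [_ eS _]]] := SelemE (G0 i) (G0 j).
  have [q [ef _ hr]] := remainderP (Selem tau x le (g i) (g j)).
  move: ef hr; set f := Selem _ _ _ _ _; set r := remainder _ _ _ _ _ => ef hr.
  apply/eqP; apply: contrapT => /negP r0.
  have hIr : I r.
    have -> : r = f - \sum_l q l * g l by rewrite ef addrAC subrr add0r.
    apply: (Isub _ _ _ (Isum q)).
    by rewrite /f eS; apply: Isub; do 2!apply: (IM).
  have /upsetG[l hl] : upset (LMset tau x le [set f | f \in tval G]) (LM r).
    by rewrite -hLM; exists r.
  have [j' hj'] := Delta_ex hl.
  by apply: (hr (LM r)) hj'; apply/suppE; case: (LMP r0).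
split=> //; apply/seteqP; split=> [_ [f [If f0 ->]]|al /upsetG[i hi]].
  apply/upsetG; move: If; rewrite hG.2 => -[h ef].
  have [|q hq eq] := admissible_representation _ h.
    move=> i j; have [q [ef' hq _]] := remainderP (Selem tau x le (g i) (g j)).
    exists q; first by move=> l al /suppE; apply: hq.
    by rewrite ef' hrem addr0.
  rewrite ef -eq; apply: admissible_LM => //.
  by rewrite eq -ef.
have [m0 em] := LM_mon (al - LM (g i))%MM.
have [f0 ef] := LM_mul m0 (G0 i).
exists (mon (al - LM (g i))%MM * g i); split=> //; first exact: IM.
by rewrite ef em submK.
Qed.

End Buchberger.

End LeadingMonomial.

Theorem theorem5p10
  (p : nat) (k : finFieldType) (kp : p \in [pchar k])
  (A : idomainType) (res : {rmorphism A -> k}) (xs0 : seq A)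
  (hA : coefficient_ring res xs0)
  (iota : k -> A) (hiota : mult_section res iota)
  (n : nat) (R : unitRingType) (eta : {rmorphism A -> R}) (x : n.-tuple R)
  (hR : iterated_skew_power_series xs0 eta x)
  (le : rel 'X_{1..n}) (hle : monomial_order (eta \o iota) x le)
  (I : set R) (hI : left_ideal I) (hI0 : exists2 f, I f & f != 0)
  (s : nat) (G : s.-tuple R) (hG : left_ideal_basis I G) :
  groebner_basis (eta \o iota) x le I G <->
  forall i j : 'I_s,
    remainder (eta \o iota) x le G
      (Selem (eta \o iota) x le (tnth G i) (tnth G j)) = 0.
Proof.
have [lR cR hdigits] := iterated_digit_map hA hiota hR.
have [c hc] := hdigits n x erefl.
have tau0 : (eta \o iota) 0 = 0 by rewrite /= (iota0 hiota) rmorph0.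
have tau1 : (eta \o iota) 1 = 1 by rewrite /= (iota1 hiota) rmorph1.
have tauM : {morph eta \o iota : a b / a * b}.
  by move=> a b; rewrite /= (iotaM hiota) rmorphM.
have G0 i : tnth G i != 0 by case: (hG.1 i).
exact: (groebner_basisP lR cR hc tau0 tau1 tauM hle).
Qed.
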